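(* Let $r\ge2$ be a constant and $2r\log n\le\lambda\in O\!\left(\frac{n^{r-1}}{\log n}\right)$. Consider the island model with the complete migration topology on $\lambda$ islands and migration probability $1/\tau$ optimizing $\mathrm{Fork}_{n,r}$. Then the expected number of rounds $E(T)$ until some island has the optimum satisfies $E(T)\in\Omega\!\left(\frac{n^{3r}+\tau\lambda n^r}{\lambda n^r+\tau\lambda^2}\right)$.
   Context: $\mathrm{Fork}_{n,r}(x)=n+1$ if $x=0^r1^{n-r}$, $n+2$ if $x=1^{n-r}0^r$ (the optimum), and $|x|_1$ otherwise. Island model on graph $G=(V,E)$, $\lambda=|V|$, parameter $\tau\ge1$ (positive integer-valued, non-decreasing function of $n$): each island's solution is initialized independently uniformly at random. In each round: with probability $1/\tau$ a migration flag is set (the same for all islands); every island creates an offspring by flipping each bit of its solution independently with probability $1/n$ and replaces its solution if the offspring's fitness is not smaller; if the flag is set, every island sends its solution to all neighbours in $G$, and each island picks uniformly at random one of the received solutions of maximum fitness and replaces its own solution by it if it is not worse. The complete topology is the complete graph on $\lambda$ vertices. Asymptotics are in $n$. *)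

(* Defs.v *)
From HB Require Import structures.
From mathcomp Require Import all_boot all_order all_algebra.
From mathcomp Require Import all_classical all_reals all_analysis.
Set Implicit Arguments. Unset Strict Implicit. Unset Printing Implicit Defensive.
Import Order.TTheory GRing.Theory Num.Theory.
Local Open Scope ring_scope.

Definition bitstr (n : nat) := {ffun 'I_n -> bool}.
Definition popul (lam n : nat) := {ffun 'I_lam -> bitstr n}.

Section IslandModel.
Variables (R : realType) (n r lam tau : nat) (G : rel 'I_lam).

Definition ones (x : bitstr n) : nat := \sum_(i < n) nat_of_bool (x i).
Definition fork_trap : bitstr n := [ffun i : 'I_n => (r <= i)%N].
Definition fork_opt : bitstr n := [ffun i : 'I_n => (i < n - r)%N].

Definition fork (x : bitstr n) : nat :=
  if x == fork_opt then (n + 2)%N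
  else if x == fork_trap then (n + 1)%N
  else ones x.

Definition hamming (x y : bitstr n) : nat := \sum_(i < n) nat_of_bool (x i != y i).

Definition mut_prob (x y : bitstr n) : R :=
  (n%:R^-1) ^+ hamming x y * (1 - n%:R^-1) ^+ (n - hamming x y).

Definition select (x y : bitstr n) : bitstr n := if (fork x <= fork y)%N then y else x.

Definition select_pop (s z : popul lam n) : popul lam n :=
  [ffun i => select (s i) (z i)].

(* probability that, during migration on the population u (all islands send
   simultaneously to all neighbours in G), island i ends up with solution y:
   it picks uniformly one neighbour whose solution has maximum fitness among
   the received ones, and adopts it if it is not worse than its own. *)
Definition mig_prob (u : popul lam n) (i : 'I_lam) (y : bitstr n) : R :=
  let N := [set j | G i j] in
  if N == finset.set0 then (y == u i)%:R
  else
    let m := (\max_(j in N) fork (u j))%N in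
    let M := [set j in N | fork (u j) == m] in
    #|M|%:R^-1 * \sum_(j in M) (y == select (u i) (u j))%:R.

Definition kernel (s s' : popul lam n) : R :=
  \sum_(z : popul lam n)
    (\prod_(i < lam) mut_prob (s i) (z i)) *
    ((1 - tau%:R^-1) * (s' == select_pop s z)%:R
     + tau%:R^-1 * \prod_(i < lam) mig_prob (select_pop s z) i (s' i)).

Definition init_prob (s : popul lam n) : R := ((2 ^ n)%:R^-1) ^+ lam.

Definition has_opt (s : popul lam n) : bool := [exists i, s i == fork_opt].

(* surv t s = Pr[no island has held the optimum in rounds 0..t, and state at
   time t is s] *)
Fixpoint surv (t : nat) (s : popul lam n) : R :=
  match t with
  | 0 => if has_opt s then 0 else init_prob s
  | t'.+1 => if has_opt s then 0
             else \sum_(s0 : popul lam n) surv t' s0 * kernel s0 s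
  end.

Definition prob_T_gt (t : nat) : R := \sum_(s : popul lam n) surv t s.

Definition expected_T : \bar R := (\sum_(0 <= t <oo) (prob_T_gt t)%:E)%E.

End IslandModel.

Definition complete_graph (lam : nat) : rel 'I_lam := fun i j => i != j.
Arguments complete_graph lam : clear implicits.

(* Main.v *)
(* Two facts drive the bound.

   Climbing. As long as no offspring is the trap [0^r 1^(n-r)] or the optimum
   [1^(n-r) 0^r], the islands optimize OneMax, whose law is invariant under
   permutations of the bit positions. Hence the expected number of times an
   island that does not hold [1^n] creates one of these two points is the
   expected number of its offspring with exactly [r] zeros divided by
   ['C(n, r)]. An island spends O(n) rounds in expectation at levels from which
   such an offspring is likely, and [lam * n / n^r = O(1 / log n)], so these
   events are negligible. Offspring of islands holding [1^n] avoid the two points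
   during O(n log n) rounds with probability at least
   [(1 - 2 n^-r)^(O(lam n log n))], which is bounded below. So with
   constant probability all islands reach [1^n] before any peak is found.

   Race. From there only [1^n], the trap and the optimum matter. With
   [eps = lam / n^r], each round finds the optimum with probability at most
   about [eps], and the trap first with constant probability; once an island is
   trapped, a migration traps all of them before the optimum is found with
   probability of order [1 / (1 + tau * eps)]; then a simultaneous flip of
   [2 r] bits is needed, which takes [n^(2 r) / lam] rounds. A potential function
   on the populations over [{1^n, trap}] turns this into a bound on [E(T)]. *)

Require Import Defs.
From HB Require Import structures.
From mathcomp Require Import all_boot all_order all_algebra perm.
From mathcomp Require Import all_classical all_reals all_analysis.
From mathcomp Require Import ring lra zify.
Set Implicit Arguments. Unset Strict Implicit. Unset Printing Implicit Defensive.
Import Order.TTheory GRing.Theory Num.Theory.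
Local Open Scope ring_scope.

(** * Product weights *)

Section ProductWeights.
Variables (R : realType) (I J : finType).
Implicit Types (F : I -> J -> R) (phi : J -> R).

Lemma sum_prod_ffun F :
  \sum_(u : {ffun I -> J}) \prod_i F i (u i) = \prod_i \sum_j F i j.
Proof. by rewrite bigA_distr_bigA. Qed.

Lemma prod_marginal F (i0 : I) phi : (forall i, \sum_j F i j = 1) ->
  \sum_(u : {ffun I -> J}) (\prod_i F i (u i)) * phi (u i0)
  = \sum_j F i0 j * phi j.
Proof.
move=> F1; pose F' i j := F i j * (if i == i0 then phi j else 1).
have -> : \sum_(u : {ffun I -> J}) (\prod_i F i (u i)) * phi (u i0)
          = \sum_(u : {ffun I -> J}) \prod_i F' i (u i).
  apply: eq_bigr => u _; rewrite (bigD1 i0) //= [RHS](bigD1 i0) //= {1}/F' eqxx.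
  rewrite -mulrA [(\prod_(_ | _) _) * _]mulrC mulrA; congr (_ * _).
  by apply: eq_bigr => i /negPf i_i0; rewrite /F' i_i0 mulr1.
rewrite sum_prod_ffun (bigD1 i0) //= [X in _ * X]big1 ?mulr1.
  by apply: eq_bigr => j _; rewrite /F' eqxx.
move=> i /negPf i_i0; rewrite -[RHS](F1 i).
by apply: eq_bigr => j _; rewrite /F' i_i0 mulr1.
Qed.

Lemma prod_one_sub_ge (b : I -> R) : (forall i, 0 <= b i <= 1) ->
  1 - \sum_i b i <= \prod_i (1 - b i).
Proof.
move=> b01.
suff [] : 0 <= \prod_i (1 - b i) <= 1 /\ 1 - \sum_i b i <= \prod_i (1 - b i) by [].
elim/big_rec2: _ => [|i s p _ [/andP[p0 p1] ps]]; first by rewrite subr0 ler01 lexx.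
have /andP[bi0 bi1] := b01 i.
by split; [apply/andP; split|]; nra.
Qed.

Lemma sum_delta (T : finType) (a : T) (phi : T -> R) :
  \sum_(x : T) (x == a)%:R * phi x = phi a.
Proof.
rewrite (bigD1 a) //= eqxx mul1r big1 ?addr0 // => x /negPf ->.
by rewrite mul0r.
Qed.

Lemma sum_delta1 (T : finType) (a : T) : \sum_(x : T) (x == a)%:R = 1 :> R.
Proof.
rewrite -[RHS](sum_delta a (fun=> 1)).
by apply: eq_bigr => x _; rewrite mulr1.
Qed.

End ProductWeights.

Lemma bernoulli_ge (R : realType) (x : R) (k : nat) : 0 <= x <= 1 ->
  1 - k%:R * x <= (1 - x) ^+ k.
Proof.
move=> x01; have := @prod_one_sub_ge R 'I_k (fun=> x) (fun=> x01).
by rewrite sumr_const prodr_const card_ord mulr_natl.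
Qed.

Lemma one_sub_inv_pow_ge (R : realType) (n : nat) : (2 <= n)%N ->
  4^-1 <= (1 - n%:R^-1 : R) ^+ n.
Proof.
move=> n2.
have n0 : (0 : R) < n%:R by rewrite ltr0n; lia.
have q0 : (0 : R) <= n%:R^-1 by rewrite invr_ge0 ltW.
have q1 : (n%:R^-1 : R) <= 2^-1 by rewrite lef_pV2 ?posrE ?ltr0n ?ler_nat //; lia.
(* Bernoulli's inequality is applied to half of the factors. *)
have nq : n%:R * n%:R^-1 = 1 :> R by rewrite divff // gt_eqF.
pose k := n./2.
have kq : (k%:R * n%:R^-1 : R) <= 2^-1.
  rewrite ler_pdivrMr // ler_pdivlMl // -natrM ler_nat /k; lia.
have k1 : 2^-1 <= (1 - n%:R^-1 : R) ^+ k.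
  by apply: le_trans (bernoulli_ge _ _); [lra|apply/andP; split; lra].
have [nodd|neven] := boolP (odd n); last first.
  have -> : n = (k + k)%N by rewrite /k; lia.
  rewrite exprD; have -> : ((k + k)%N = n) by rewrite /k; lia.
  nra.
have nE : n = (k + k + 1)%N by rewrite /k; lia.
have kq' : (k%:R * n%:R^-1 : R) = (1 - n%:R^-1) / 2.
  have : n%:R = 2 * k%:R + 1 :> R by rewrite {1}nE !natrD; ring.
  by move=> E; move: nq; rewrite {1}E; lra.
have k2 : (1 + n%:R^-1) / 2 <= (1 - n%:R^-1 : R) ^+ k.
  by apply: le_trans (bernoulli_ge _ _); [lra|apply/andP; split; lra].
rewrite {2}nE !exprD expr1.
have q3 : n%:R^-1 <= 3^-1 :> R by rewrite lef_pV2 ?posrE ?ltr0n ?ler_nat //; lia.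
set q := n%:R^-1 in q0 q1 q3 k2 *.
have : ((1 + q) / 2) * ((1 + q) / 2) <= (1 - q) ^+ k * (1 - q) ^+ k by nra.
nra.
Qed.

(** * Mutation and elitist selection *)

Section Mutation.
Variables (R : realType) (n : nat).
Implicit Types (x y : bitstr n) (f : bitstr n -> nat).
Local Notation q := (@GRing.inv R n%:R).
Local Notation mut := (mut_prob R).

Lemma rate_itv : 0 <= q <= 1.
Proof.
case: n => [|m]; first by rewrite invr0 lexx ler01.
by rewrite invr_ge0 ler0n invf_le1 ?ltr0Sn // ler1n.
Qed.

Lemma hammingE x y : hamming x y = #|[pred i | x i != y i]|.
Proof.
rewrite -sum1_card big_mkcond /=; apply: eq_bigr => i _.
by rewrite inE; case: (x i != y i).
Qed.

Lemma mut_probE x y :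
  mut x y = \prod_i (if x i != y i then q else 1 - q).
Proof.
rewrite (bigID [pred i | x i != y i]) /= /mut_prob.
rewrite (eq_bigr (fun=> q)); last by move=> i ->.
rewrite [X in _ = _ * X](eq_bigr (fun=> 1 - q)); last by move=> i /negPf ->.
rewrite !prodr_const hammingE; congr (_ * _ ^+ _).
by rewrite -[X in (X - _)%N]card_ord -(cardC [pred i | x i != y i]) addKn.
Qed.

Lemma mut_ge0 x y : 0 <= mut x y.
Proof.
have /andP[q0 q1] := rate_itv.
by rewrite mulr_ge0 // exprn_ge0 // subr_ge0.
Qed.

Lemma mut_coord_sum x i : \sum_(b : bool) (if x i != b then q else 1 - q) = 1.
Proof. by rewrite big_bool; case: (x i) => /=; rewrite ?subrK // addrC subrK. Qed.

Lemma mut_sum1 x : \sum_y mut x y = 1.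
Proof.
under eq_bigr => y _ do rewrite mut_probE.
rewrite (sum_prod_ffun (fun i b => if x i != b then q else 1 - q)).
by rewrite big1 // => i _; rewrite mut_coord_sum.
Qed.

Lemma mut_flip_bit x i : \sum_y mut x y * (x i != y i)%:R = q.
Proof.
under eq_bigr => y _ do rewrite mut_probE.
rewrite (prod_marginal (F := fun j b => if x j != b then q else 1 - q) i
  (fun b => (x i != b)%:R)); last exact: mut_coord_sum.
by rewrite big_bool; case: (x i) => /=; rewrite mulr0 mulr1 ?add0r ?addr0.
Qed.

Lemma mut_le_rate x y d : (d <= hamming x y)%N -> mut x y <= q ^+ d.
Proof.
have /andP[q0 q1] := rate_itv; move=> dh.
apply: (@le_trans _ _ (q ^+ hamming x y)).
  rewrite ler_piMr ?exprn_ge0 // exprn_ile1 //; lra.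
by rewrite ler_wiXn2l.
Qed.

Lemma mut_ge_rate x y : (2 <= n)%N -> q ^+ hamming x y / 4 <= mut x y.
Proof.
have /andP[q0 q1] := rate_itv; move=> n2.
rewrite ler_wpM2l ?exprn_ge0 //.
apply: le_trans (one_sub_inv_pow_ge R n2) _.
by rewrite ler_wiXn2l ?leq_subr //; lra.
Qed.

Definition zeros x : nat := \sum_(i < n) nat_of_bool (~~ x i).

Lemma zerosE x : zeros x = #|[pred i | ~~ x i]|.
Proof.
rewrite -sum1_card big_mkcond /=; apply: eq_bigr => i _.
by rewrite inE; case: (x i).
Qed.

Lemma ones_zeros x : (ones x + zeros x = n)%N.
Proof.
rewrite -big_split /= -[RHS]card_ord -sum1_card.
by apply: eq_bigr => i _; case: (x i).
Qed.

Lemma zeros_le x : (zeros x <= n)%N.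
Proof. by have := ones_zeros x; lia. Qed.

Lemma leq_ones_zeros x y : (ones x <= ones y)%N = (zeros y <= zeros x)%N.
Proof. by have := ones_zeros x; have := ones_zeros y; lia. Qed.

Definition all1 : bitstr n := [ffun=> true].

Lemma zeros_eq0 x : (zeros x == 0)%N = (x == all1).
Proof.
apply/idP/eqP => [|->]; last by rewrite /zeros big1 // => i _; rewrite ffunE.
rewrite /zeros sum_nat_eq0 => /forallP z0; apply/ffunP => i.
by have := z0 i; rewrite ffunE /=; case: (x i).
Qed.

(* Markov's inequality for the number of flipped zeros, of which at least half
   have to flip. *)
Lemma mut_level_le (k : nat) x : (0 < k)%N -> (2 * k <= zeros x)%N ->
  \sum_(y | zeros y == k) mut x y <= 2 * q.
Proof.
move=> k0 zx; have z0 : (0 : R) < (zeros x)%:R by rewrite ltr0n; lia.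
apply: (@le_trans _ _ (\sum_y mut x y *
   ((2 / (zeros x)%:R) * \sum_i (~~ x i)%:R * (x i != y i)%:R))).
  rewrite big_mkcond /=; apply: ler_sum => y _; case: ifP => [/eqP zy|_].
    rewrite -{1}[mut x y]mulr1 ler_wpM2l ?mut_ge0 //.
    rewrite mulrAC ler_pdivlMr // mul1r.
    have -> : \sum_i (~~ x i)%:R * (x i != y i)%:R
              = (\sum_i (~~ x i && (x i != y i)))%N%:R :> R.
      by rewrite natr_sum; apply: eq_bigr => i _; rewrite -natrM mulnb.
    rewrite -natrM ler_nat.
    have : (zeros x <= zeros y + \sum_i (~~ x i && (x i != y i)))%N.
      by rewrite -big_split; apply: leq_sum => i _; case: (x i) (y i) => -[].
    by rewrite zy; lia.
  rewrite mulr_ge0 ?mut_ge0 // mulr_ge0 ?divr_ge0 // sumr_ge0 // => i _.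
rewrite le_eqVlt; apply/orP; left; apply/eqP.
under eq_bigr => y _ do rewrite mulrCA mulr_sumr.
rewrite -mulr_sumr exchange_big /=.
under eq_bigr => i _ do under eq_bigr => y _ do rewrite mulrCA.
under eq_bigr => i _ do rewrite -mulr_sumr mut_flip_bit.
by rewrite -mulr_suml -natr_sum mulrA divfK // gt_eqF.
Qed.

Definition flip_bit x (i : 'I_n) : bitstr n := [ffun j => (j == i) (+) x j].

Lemma hamming_flip_bit x i : hamming x (flip_bit x i) = 1%N.
Proof.
rewrite /hamming (bigD1 i) //= ffunE eqxx /= big1 => [|j /negPf ji].
  by case: (x i).
by rewrite ffunE ji eqxx.
Qed.

Lemma flip_bit_inj x : injective (flip_bit x).
Proof.
move=> i j /ffunP/(_ i); rewrite !ffunE eqxx.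
by case: eqP => //; case: (x i).
Qed.

Lemma zeros_flip_bit x i : ~~ x i -> zeros (flip_bit x i) = (zeros x).-1.
Proof.
move=> xi; rewrite /zeros (bigD1 i) //= [in RHS](bigD1 i) //= ffunE eqxx xi /=.
rewrite (negPf xi) /= add0n; apply: eq_bigr => j /negPf ji.
by rewrite ffunE ji.
Qed.

Definition sel f x y := if (f x <= f y)%N then y else x.

Definition step f x (u : bitstr n) : R := \sum_y mut x y * (u == sel f x y)%:R.

Lemma step_ge0 f x u : 0 <= step f x u.
Proof. by apply: sumr_ge0 => y _; rewrite mulr_ge0 ?mut_ge0. Qed.

Lemma step_expect f x (phi : bitstr n -> R) :
  \sum_u step f x u * phi u = \sum_y mut x y * phi (sel f x y).
Proof.
under eq_bigr => u _ do rewrite mulr_suml.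
rewrite exchange_big /=; apply: eq_bigr => y _.
under eq_bigr => u _ do rewrite -mulrA.
by rewrite -mulr_sumr sum_delta.
Qed.

Lemma step_sum1 f x : \sum_u step f x u = 1.
Proof.
rewrite -(mut_sum1 x); have := step_expect f x (fun=> 1).
under eq_bigr => u _ do rewrite mulr1.
by move->; apply: eq_bigr => y _; rewrite mulr1.
Qed.

Lemma step_all1 u : step (@ones n) all1 u = (u == all1)%:R.
Proof.
rewrite -[RHS]mul1r -[X in X * _](mut_sum1 all1) mulr_suml; apply: eq_bigr => y _.
suff -> : sel (@ones n) all1 y = all1 by [].
rewrite /sel leq_ones_zeros; case: ifP => //.
have /eqP -> : zeros all1 == 0%N by rewrite zeros_eq0.
by rewrite leqn0 zeros_eq0 => /eqP.
Qed.

Lemma zeros_sel x y : (zeros (sel (@ones n) x y) <= zeros x)%N.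
Proof. by rewrite /sel leq_ones_zeros; case: ifP. Qed.

(* Only the mutations flipping a single zero are counted. *)
Lemma step_drift (g : nat -> R) x : (2 <= n)%N ->
  {homo g : a b / (a <= b)%N >-> a <= b} ->
  \sum_u step (@ones n) x u * g (zeros u)
  <= g (zeros x) - (zeros x)%:R * (q / 4) * (g (zeros x) - g (zeros x).-1).
Proof.
move=> n2 gmono; rewrite (step_expect _ _ (fun u => g (zeros u))).
set d := g (zeros x) - g (zeros x).-1.
have d0 : 0 <= d by rewrite subr_ge0 gmono // leq_pred.
rewrite -[g (zeros x)]mul1r -[X in X * g _](mut_sum1 x) mulr_suml lerBrDl.
rewrite -lerBrDr -sumrB.
under eq_bigr => y _ do rewrite -mulrBr.
have dec_ge0 y : 0 <= mut x y * (g (zeros x) - g (zeros (sel (@ones n) x y))).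
  by rewrite mulr_ge0 ?mut_ge0 // subr_ge0 gmono // zeros_sel.
pose A := [set flip_bit x i | i in [pred i | ~~ x i]].
apply: (@le_trans _ _ (\sum_(y in A) mut x y *
    (g (zeros x) - g (zeros (sel (@ones n) x y))))); last first.
  rewrite big_mkcond /=; apply: ler_sum => y _; case: ifP => // _.
rewrite big_imset /=; last by move=> i j _ _; exact: flip_bit_inj.
rewrite [X in X%:R * _]zerosE -sum1_card natr_sum !mulr_suml; apply: ler_sum => i.
rewrite inE => xi; rewrite -mulrA mul1r /sel leq_ones_zeros zeros_flip_bit //.
rewrite leq_pred zeros_flip_bit // -/d ler_wpM2r //.
by have := mut_ge_rate x (flip_bit x i) n2; rewrite hamming_flip_bit expr1.
Qed.

End Mutation.

(** * Migration, Markov chains and bit permutations *)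

Lemma prod_eq_ffun (R : realType) (I J : finType) (u v : {ffun I -> J}) :
  \prod_i (u i == v i)%:R = (u == v)%:R :> R.
Proof.
have [->|] := eqVneq u v; first by rewrite big1 // => i _; rewrite eqxx.
move=> uv; have [i ui] : exists i, u i != v i.
  apply/existsP; apply: contraNT uv; rewrite negb_exists => /forallP uv.
  by apply/eqP/ffunP => i; apply/eqP; rewrite -[_ == _]negbK uv.
by rewrite (bigD1 i) //= (negPf ui) mul0r.
Qed.

Section Islands.
Variables (R : realType) (n lam tau : nat) (G : rel 'I_lam).
Implicit Types (f : bitstr n -> nat) (s u : popul lam n) (x y : bitstr n).

Definition mig_weight f u (i : 'I_lam) y : R :=
  let N := [set j | G i j] in
  if N == finset.set0 then (y == u i)%:R
  else
    let m := (\max_(j in N) f (u j))%N in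
    let M := [set j in N | f (u j) == m] in
    #|M|%:R^-1 * \sum_(j in M) (y == sel f (u i) (u j))%:R.

Definition migrate f u s' : R :=
  (1 - tau%:R^-1) * (s' == u)%:R + tau%:R^-1 * \prod_i mig_weight f u i (s' i).

Definition evolve (Q : bitstr n -> bitstr n -> R) f s s' : R :=
  \sum_(u : popul lam n) (\prod_i Q (s i) (u i)) * migrate f u s'.

Lemma kernelE (r : nat) s s' :
  Defs.kernel R r tau G s s' = evolve (step R (fork r)) (fork r) s s'.
Proof.
rewrite /evolve; under eq_bigr => u _ do
  rewrite bigA_distr_bigA mulr_suml.
rewrite exchange_big /=; apply: eq_bigr => z _.
under eq_bigr => u _ do rewrite big_split /= -mulrA.
rewrite -mulr_sumr; congr (_ * _).
transitivity (\sum_u (u == select_pop r s z)%:R * migrate (fork r) u s').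
  by rewrite sum_delta.
apply: eq_bigr => u _; congr (_ * _); rewrite -prod_eq_ffun.
by apply: eq_bigr => i _; rewrite ffunE.
Qed.

Lemma mig_weight_ge0 f u i y : 0 <= mig_weight f u i y.
Proof.
rewrite /mig_weight; case: ifP => _; first by [].
by rewrite mulr_ge0 ?invr_ge0 // sumr_ge0.
Qed.

Lemma mig_weight_supp f u i y : mig_weight f u i y != 0 ->
  (f (u i) <= f y)%N /\ exists j, y = u j.
Proof.
have key j : y = sel f (u i) (u j) -> (f (u i) <= f y)%N /\ exists j, y = u j.
  by move->; rewrite /sel; case: ifP => ?; split => //; [exists j|exists i].
rewrite /mig_weight; case: ifP => _.
  by case: (eqVneq y (u i)) => [-> _|_]; [split => //; exists i|rewrite eqxx].
have [/existsP[j /andP[_ /eqP yj]] _|] :=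
  boolP [exists j, (j \in [set j in [set j | G i j] |
    f (u j) == (\max_(j in [set j | G i j]) f (u j))%N]) &&
     (y == sel f (u i) (u j))]; first exact: key yj.
rewrite negb_exists => /forallP no.
rewrite [X in _ * X]big1 ?mulr0 ?eqxx // => j jM.
by have := no j; rewrite jM /= => /negPf ->.
Qed.

Lemma mig_weight_sum1 f u i : \sum_y mig_weight f u i y = 1.
Proof.
rewrite /mig_weight.
case: (boolP ([set j | G i j] == finset.set0)) => [_|/set0Pn[j0 j0N]].
  by rewrite sum_delta1.
have N0 : (0 < #|[set j | G i j]|)%N by apply/card_gt0P; exists j0.
have [j jN jm] := eq_bigmax_cond (fun j => f (u j)) N0.
set M := [set j in _ | _].
rewrite -mulr_sumr exchange_big /=.
under eq_bigr => k _ do rewrite sum_delta1.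
rewrite sumr_const mulVf // pnatr_eq0 -lt0n card_gt0.
by apply/set0Pn; exists j; rewrite inE; apply/andP; split => //; rewrite jm.
Qed.

(* The weight depends on the population only through the fitness of the islands
   and through the islands that hold the solution at hand. *)
Lemma mig_weight_congr f f' u u' i y y' : (forall j, f (u j) = f' (u' j)) ->
  (forall j, (y == u j) = (y' == u' j)) ->
  mig_weight f u i y = mig_weight f' u' i y'.
Proof.
move=> /funext ff' yy'.
pose W (F : 'I_lam -> nat) (d : 'I_lam -> R) : R :=
  let N := [set j | G i j] in
  if N == finset.set0 then d i
  else
    let m := (\max_(j in N) F j)%N in
    let M := [set j in N | F j == m] in
    #|M|%:R^-1 * \sum_(j in M) d (if (F i <= F j)%N then j else i).
have WE (h : bitstr n -> nat) v z : mig_weight h v i z =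
    W (fun j => h (v j)) (fun j => (z == v j)%:R).
  rewrite /mig_weight /W; case: ifP => // _; congr (_ * _).
  by apply: eq_bigr => j _; rewrite /sel; case: ifP.
rewrite !WE ff'; congr (W _ _); apply/funext => j; by rewrite yy'.
Qed.

Lemma migrate_congr f f' u s' : (forall j, f (u j) = f' (u j)) ->
  migrate f u s' = migrate f' u s'.
Proof.
move=> ff'; rewrite /migrate; congr (_ + _ * _).
by apply: eq_bigr => i _; apply: mig_weight_congr => // j; rewrite ff'.
Qed.

Hypothesis tau_gt0 : (0 < tau)%N.

Lemma flag_itv : 0 <= (tau%:R^-1 : R) <= 1.
Proof. by rewrite invr_ge0 ler0n invf_le1 ?ltr0n // ler1n. Qed.

Lemma migrate_ge0 f u s' : 0 <= migrate f u s'.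
Proof.
have /andP[t0 t1] := flag_itv.
rewrite addr_ge0 // mulr_ge0 // ?subr_ge0 //.
by apply: prodr_ge0 => i _; exact: mig_weight_ge0.
Qed.

Lemma migrate_sum1 f u : \sum_s' migrate f u s' = 1.
Proof.
rewrite big_split /= -!mulr_sumr sum_delta1 sum_prod_ffun.
by rewrite big1 ?mulr1 ?subrK // => i _; rewrite mig_weight_sum1.
Qed.

Lemma migrate_supp f u s' : migrate f u s' != 0 ->
  forall i, (f (u i) <= f (s' i))%N /\ exists j, s' i = u j.
Proof.
move=> m0 i; have [->|su] := eqVneq s' u; first by split => //; exists i.
move: m0; rewrite /migrate (negPf su) mulr0 add0r mulf_eq0 negb_or => /andP[_].
rewrite prodf_seq_neq0 => /allP/(_ i); rewrite mem_index_enum => /(_ isT).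
exact: mig_weight_supp.
Qed.

Lemma migrate_expect_ge f u (phi : popul lam n -> R) (c : R) :
  (forall s', (forall i, (f (u i) <= f (s' i))%N /\ exists j, s' i = u j) ->
     c <= phi s') ->
  c <= \sum_s' migrate f u s' * phi s'.
Proof.
move=> cphi; rewrite -[c]mul1r -(migrate_sum1 f u) mulr_suml.
apply: ler_sum => s' _.
have [->|/migrate_supp m] := eqVneq (migrate f u s') 0; first by rewrite !mul0r.
by rewrite ler_wpM2l ?migrate_ge0 // cphi.
Qed.

Lemma migrate_expect_le f u (phi : popul lam n -> R) (c : R) :
  (forall s', (forall i, (f (u i) <= f (s' i))%N /\ exists j, s' i = u j) ->
     phi s' <= c) ->
  \sum_s' migrate f u s' * phi s' <= c.
Proof.
move=> cphi; rewrite -lerN2 -sumrN.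
under eq_bigr => s' _ do rewrite -mulrN.
by apply: migrate_expect_ge => s' /cphi; rewrite lerN2.
Qed.

Lemma evolve_expect Q f s (phi : popul lam n -> R) :
  \sum_s' evolve Q f s s' * phi s' =
  \sum_(u : popul lam n) (\prod_i Q (s i) (u i)) * \sum_s' migrate f u s' * phi s'.
Proof.
under eq_bigr => s' _ do rewrite mulr_suml.
rewrite exchange_big /=; apply: eq_bigr => u _.
by rewrite mulr_sumr; apply: eq_bigr => s' _; rewrite mulrA.
Qed.

Lemma evolve_ge0 Q f s s' : (forall x y, 0 <= Q x y) -> 0 <= evolve Q f s s'.
Proof.
move=> Q0; apply: sumr_ge0 => u _; rewrite mulr_ge0 ?migrate_ge0 //.
by apply: prodr_ge0.
Qed.

Lemma evolve_mass Q f s : \sum_s' evolve Q f s s' = \prod_i \sum_y Q (s i) y.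
Proof.
rewrite -sum_prod_ffun exchange_big /=; apply: eq_bigr => u _.
by rewrite -mulr_sumr migrate_sum1 mulr1.
Qed.

End Islands.

Section Chain.
Variables (R : realType) (T : finType).
Implicit Types (K : T -> T -> R) (d : T -> R).

Fixpoint chain K d t (s : T) : R :=
  if t is t'.+1 then \sum_s0 chain K d t' s0 * K s0 s else d s.

Lemma chain_ge0 K d t s : (forall s s', 0 <= K s s') -> (forall s, 0 <= d s) ->
  0 <= chain K d t s.
Proof.
by move=> K0 d0; elim: t s => //= t IH s; apply: sumr_ge0 => s0 _; rewrite mulr_ge0.
Qed.

Lemma chain_le K K' d d' t s :
  (forall s s', 0 <= K s s' <= K' s s') -> (forall s, 0 <= d s <= d' s) ->
  chain K d t s <= chain K' d' t s.
Proof.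
move=> KK' dd'.
have K0 s1 s2 : 0 <= K s1 s2 by case/andP: (KK' s1 s2).
have d0 s1 : 0 <= d s1 by case/andP: (dd' s1).
elim: t s => /= [|t IH] s; first by case/andP: (dd' s).
apply: ler_sum => s0 _; have /andP[_ K1] := KK' s0 s.
by apply: ler_pM => //; exact: chain_ge0.
Qed.

Lemma chain_expect K d t (phi : T -> R) :
  \sum_s chain K d t.+1 s * phi s
  = \sum_s chain K d t s * \sum_s' K s s' * phi s'.
Proof.
rewrite /=; under eq_bigr => s _ do rewrite mulr_suml.
rewrite exchange_big /=; apply: eq_bigr => s0 _.
by rewrite mulr_sumr; apply: eq_bigr => s _; rewrite mulrA.
Qed.

End Chain.

Section Symmetry.
Variables (R : realType) (n lam tau : nat) (G : rel 'I_lam).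
Implicit Types (sg : {perm 'I_n}) (x y : bitstr n) (s u : popul lam n).

Definition permute sg x : bitstr n := [ffun i => x (sg i)].
Definition permute_pop sg s : popul lam n := [ffun i => permute sg (s i)].

Lemma permute_inj sg : injective (permute sg).
Proof.
move=> x y /ffunP xy; apply/ffunP => i.
by have := xy (perm_inv sg i); rewrite !ffunE permKV.
Qed.

Lemma permute_pop_inj sg : injective (permute_pop sg).
Proof.
move=> s u /ffunP su; apply/ffunP => i.
by have := su i; rewrite !ffunE => /permute_inj.
Qed.

Lemma permute_transitive x y : zeros x = zeros y -> exists sg, y = permute sg x.
Proof.
move=> xy.
have : perm_eq [tuple y i | i < n] [tuple x i | i < n].
  apply/seq.permP => P.
  suff E (z : bitstr n) : count P [tuple z i | i < n] =
      (P true * (n - zeros z) + P false * zeros z)%N.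
    by rewrite !E xy.
  have -> : (n - zeros z = ones z)%N by rewrite -[X in (X - _)%N](ones_zeros z) addnK.
  rewrite /= count_map -sumn_count sumnE big_map big_enum /= !big_distrr -big_split /=.
  by apply: eq_bigr => i _; case: (z i); rewrite /= !muln1 !muln0 ?addn0.
case/tuple_permP => sg E; exists sg; apply/ffunP => i.
have := congr1 (fun l => nth false l i) E.
by rewrite -!tnth_nth !tnth_mktuple ffunE.
Qed.

Lemma ones_permute sg x : ones (permute sg x) = ones x.
Proof.
rewrite /ones [RHS](reindex_inj (@perm_inj _ sg)).
by apply: eq_bigr => i _; rewrite ffunE.
Qed.

Lemma mut_permute sg x y :
  mut_prob R (permute sg x) (permute sg y) = mut_prob R x y.
Proof.
suff E : hamming (permute sg x) (permute sg y) = hamming x y by rewrite /mut_prob E.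
rewrite /hamming [RHS](reindex_inj (@perm_inj _ sg)).
by apply: eq_bigr => i _; rewrite !ffunE.
Qed.

Lemma sel_permute sg x y :
  sel (@ones n) (permute sg x) (permute sg y) = permute sg (sel (@ones n) x y).
Proof. by rewrite /sel !ones_permute; case: ifP. Qed.

Lemma step_permute sg x y :
  step R (@ones n) (permute sg x) (permute sg y) = step R (@ones n) x y.
Proof.
rewrite /step (reindex_inj (@permute_inj sg)); apply: eq_bigr => z _.
by rewrite mut_permute sel_permute (inj_eq (@permute_inj sg)).
Qed.

Lemma mig_weight_permute sg u i y :
  mig_weight R G (@ones n) (permute_pop sg u) i (permute sg y)
  = mig_weight R G (@ones n) u i y.
Proof.
apply: mig_weight_congr => j; rewrite ffunE ?ones_permute //.
by rewrite (inj_eq (@permute_inj sg)).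
Qed.

Lemma migrate_permute sg u s :
  migrate R tau G (@ones n) (permute_pop sg u) (permute_pop sg s)
  = migrate R tau G (@ones n) u s.
Proof.
rewrite /migrate (inj_eq (@permute_pop_inj sg)); congr (_ + _ * _).
by apply: eq_bigr => i _; rewrite [X in mig_weight _ _ _ _ _ X]ffunE mig_weight_permute.
Qed.

Definition onemax_kernel := @evolve R n lam tau G (step R (@ones n)) (@ones n).
Definition onemax_law := chain onemax_kernel (@init_prob R n lam).

Lemma onemax_law_permute sg t s : onemax_law t (permute_pop sg s) = onemax_law t s.
Proof.
rewrite /onemax_law; elim: t s => //= t IH s.
rewrite (reindex_inj (@permute_pop_inj sg)); apply: eq_bigr => s0 _.
rewrite IH; congr (_ * _).
rewrite /onemax_kernel /evolve (reindex_inj (@permute_pop_inj sg)).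
apply: eq_bigr => u _; rewrite migrate_permute; congr (_ * _).
by apply: eq_bigr => i _; rewrite !ffunE step_permute.
Qed.

Definition climbing_hit x y : R := (x != all1 n)%:R * mut_prob R x y.

Lemma climbing_hit_ge0 x y : 0 <= climbing_hit x y.
Proof. by apply: mulr_ge0 => //; exact: mut_ge0. Qed.

Lemma climbing_hit_permute sg x y :
  climbing_hit (permute sg x) (permute sg y) = climbing_hit x y.
Proof.
rewrite /climbing_hit mut_permute; congr ((~~ _)%:R * _).
have E : permute sg (all1 n) = all1 n by apply/ffunP => i; rewrite !ffunE.
by rewrite -{1}E (inj_eq (@permute_inj sg)).
Qed.

Lemma expect_hit_level t x y : zeros x = zeros y ->
  \sum_s onemax_law t s * \sum_i climbing_hit (s i) x
  = \sum_s onemax_law t s * \sum_i climbing_hit (s i) y.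
Proof.
move=> /permute_transitive[sg ->].
rewrite [RHS](reindex_inj (@permute_pop_inj sg)); apply: eq_bigr => s _.
rewrite onemax_law_permute; congr (_ * _); apply: eq_bigr => i _.
by rewrite ffunE climbing_hit_permute.
Qed.

End Symmetry.

(** * The OneMax process *)

Section Init.
Variables (R : realType) (n lam : nat).

Lemma unif_sum1 : \sum_(x : bitstr n) ((2 ^ n)%:R^-1 : R) = 1.
Proof.
rewrite sumr_const card_ffun card_bool card_ord -[_ *+ _]mulr_natr mulVf //.
Qed.

Lemma init_probE (s : popul lam n) :
  init_prob R s = \prod_(i < lam) (2 ^ n)%:R^-1.
Proof. by rewrite prodr_const card_ord. Qed.

Lemma init_ge0 (s : popul lam n) : 0 <= init_prob R s.
Proof. by rewrite exprn_ge0 // invr_ge0. Qed.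

Lemma init_sum1 : \sum_(s : popul lam n) init_prob R s = 1.
Proof.
under eq_bigr => s _ do rewrite init_probE.
rewrite (sum_prod_ffun (fun (_ : 'I_lam) (_ : bitstr n) => (2 ^ n)%:R^-1)).
by rewrite big1 // => i _; exact: unif_sum1.
Qed.

Lemma init_marginal (i : 'I_lam) (y : bitstr n) :
  \sum_(s : popul lam n) init_prob R s * (s i == y)%:R = (2 ^ n)%:R^-1.
Proof.
under eq_bigr => s _ do rewrite init_probE.
rewrite (prod_marginal (F := fun (_ : 'I_lam) (_ : bitstr n) => (2 ^ n)%:R^-1) i
  (fun x => (x == y)%:R)); last by move=> _; exact: unif_sum1.
by rewrite -mulr_sumr sum_delta1 mulr1.
Qed.

End Init.

Lemma card_level n k : ('C(n, k) <= #|[pred y : bitstr n | zeros y == k]|)%N.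
Proof.
rewrite -{1}[n]card_ord -card_draws.
pose h (A : {set 'I_n}) : bitstr n := [ffun i => i \notin A].
have h_inj : injective h.
  move=> A B /ffunP AB; apply/setP => i.
  by have := AB i; rewrite !ffunE => /negb_inj.
rewrite -(card_imset _ h_inj); apply/subset_leq_card/fintype.subsetP => y /imsetP[A].
rewrite !inE => /eqP <- ->; rewrite zerosE; apply/eqP/eq_card => i.
by rewrite !inE ffunE negbK.
Qed.

Lemma bin_le_exp2 n k : ('C(n, k) <= 2 ^ n)%N.
Proof.
apply: leq_trans (card_level n k) _.
by rewrite -[n in (2 ^ n)%N]card_ord -card_bool -card_ffun max_card.
Qed.

Section Climb.
Variables (R : realType) (n lam tau : nat) (G : rel 'I_lam).
Hypotheses (n_ge2 : (2 <= n)%N) (tau_gt0 : (0 < tau)%N).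
Implicit Types (x y : bitstr n) (s u : popul lam n).
Local Notation q := (@GRing.inv R n%:R).
Local Notation K1 := (@onemax_kernel R n lam tau G).
Local Notation mu := (@onemax_law R n lam tau G).

Lemma onemax_kernel_ge0 s s' : 0 <= K1 s s'.
Proof. by apply: evolve_ge0 => // x y; exact: step_ge0. Qed.

Lemma onemax_law_ge0 t s : 0 <= mu t s.
Proof. by apply: chain_ge0; [exact: onemax_kernel_ge0|exact: init_ge0]. Qed.

Lemma onemax_drift (g : nat -> R) s :
  {homo g : a b / (a <= b)%N >-> a <= b} ->
  \sum_s' K1 s s' * \sum_i g (zeros (s' i)) <=
  \sum_i (g (zeros (s i)) - (zeros (s i))%:R * (q / 4) *
          (g (zeros (s i)) - g (zeros (s i)).-1)).
Proof.
move=> gmono; rewrite evolve_expect.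
apply: (@le_trans _ _ (\sum_(u : popul lam n)
   (\prod_i step R (@ones n) (s i) (u i)) * \sum_i g (zeros (u i)))).
  apply: ler_sum => u _; apply: ler_wpM2l.
    by apply: prodr_ge0 => i _; exact: step_ge0.
  apply: migrate_expect_le => // s' us'; apply: ler_sum => i _.
  by apply: gmono; rewrite -leq_ones_zeros; case: (us' i).
under eq_bigr => u _ do rewrite mulr_sumr.
rewrite exchange_big /=; apply: ler_sum => i _.
rewrite (prod_marginal (F := fun i => step R (@ones n) (s i)) i
  (fun v => g (zeros v))); last by move=> j; exact: step_sum1.
exact: step_drift.
Qed.

Lemma onemax_expected_zeros t :
  \sum_s mu t s * \sum_i (zeros (s i))%:R <= lam%:R * n%:R * (1 - q / 4) ^+ t.
Proof.
have /andP[q0 q1] := rate_itv R n.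
elim: t => [|t IH].
  rewrite expr0 mulr1 -[leRHS]mul1r -[X in _ <= X * _](init_sum1 R n lam) mulr_suml.
  apply: ler_sum => s _; rewrite ler_wpM2l ?init_ge0 //.
  rewrite -natrM -natr_sum ler_nat.
  rewrite -[lam in leqRHS]card_ord -sum_nat_const; apply: leq_sum => i _.
  exact: zeros_le.
rewrite exprSr mulrA; apply: le_trans (ler_wpM2r _ IH); last by lra.
rewrite chain_expect mulr_suml; apply: ler_sum => s _.
rewrite -mulrA ler_wpM2l ?onemax_law_ge0 //.
apply: le_trans (@onemax_drift (fun k => k%:R) s _) _.
  by move=> a b ab; rewrite ler_nat.
rewrite mulr_suml; apply: ler_sum => i _.
case: (zeros (s i)) => [|z] /=; first by rewrite !mul0r subr0.
by rewrite -natr1; lra.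
Qed.

Variable r : nat.
Hypothesis r_gt0 : (0 < r)%N.

Definition hit_potential (z : nat) : R :=
  4 * n%:R * ((minn z (2 * r))%:R + 2 * q * z%:R).

Lemma hit_potential_mono :
  {homo hit_potential : a b / (a <= b)%N >-> a <= b}.
Proof.
have /andP[q0 q1] := rate_itv R n.
move=> a b ab; rewrite ler_wpM2l ?mulr_ge0 // lerD //.
  by rewrite ler_nat; lia.
by rewrite ler_wpM2l ?mulr_ge0 // ler_nat.
Qed.

Lemma hit_potential_le x : hit_potential (zeros x) <= 4 * n%:R * (2 * r%:R + 2).
Proof.
rewrite ler_wpM2l ?mulr_ge0 // lerD //; first by rewrite -natrM ler_nat geq_minr.
rewrite -mulrA -[leRHS]mulr1 ler_wpM2l // mulrC ler_pdivrMr ?mul1r.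
  by rewrite ler_nat zeros_le.
by rewrite ltr0n; lia.
Qed.

Lemma hit_potential_ge0 z : 0 <= hit_potential z.
Proof.
have /andP[q0 q1] := rate_itv R n.
by rewrite mulr_ge0 ?mulr_ge0 // addr_ge0 // !mulr_ge0.
Qed.

Lemma level_hit_le x :
  \sum_(y | zeros y == r) climbing_hit R x y <=
  (zeros x)%:R * (q / 4) * (hit_potential (zeros x) - hit_potential (zeros x).-1).
Proof.
have q0 : 0 < q by rewrite invr_gt0 ltr0n ltnW.
have nq : n%:R * q = 1 by rewrite divff // pnatr_eq0; lia.
rewrite /climbing_hit -mulr_sumr.
have [->|x1] := eqVneq x (all1 n).
  by rewrite mul0r mulr_ge0 // ?subr_ge0 ?hit_potential_mono ?leq_pred //
     mulr_ge0 // divr_ge0 // ltW.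
have z0 : (0 < zeros x)%N by rewrite lt0n zeros_eq0.
have pE : (zeros x)%:R * (q / 4) *
    (hit_potential (zeros x) - hit_potential (zeros x).-1)
    = (zeros x)%:R * ((minn (zeros x) (2 * r))%:R - (minn (zeros x).-1 (2 * r))%:R
        + 2 * q).
  have -> : (zeros x)%:R * (q / 4) *
    (hit_potential (zeros x) - hit_potential (zeros x).-1)
    = (n%:R * q) * (zeros x)%:R * ((minn (zeros x) (2 * r))%:R -
        (minn (zeros x).-1 (2 * r))%:R + 2 * q * ((zeros x)%:R - (zeros x).-1%:R)).
  have nz : (n%:R : R) != 0 by rewrite pnatr_eq0; lia.
    by rewrite /hit_potential; field.
  rewrite nq mul1r; congr (_ * (_ + _)).
  have -> : (zeros x)%:R = (zeros x).-1%:R + 1 :> R by rewrite natr1 prednK.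
  by ring.
rewrite mul1r pE.
have [small|large] := boolP (zeros x <= 2 * r)%N.
  apply: (@le_trans _ _ 1).
    rewrite -(mut_sum1 R x) [leRHS](bigID (fun y => zeros y == r)) /= lerDl.
    by apply: sumr_ge0 => y _; exact: mut_ge0.
  have -> : minn (zeros x) (2 * r) = ((minn (zeros x).-1 (2 * r)) + 1)%N by lia.
  by rewrite natrD -[leLHS]mul1r ler_pM // ?ler1n //; lra.
have -> : minn (zeros x) (2 * r) = (minn (zeros x).-1 (2 * r))%N by lia.
rewrite subrr add0r; apply: le_trans (@mut_level_le R n r x r_gt0 _) _.
  by lia.
by rewrite ler_peMl ?ler1n // mulr_ge0 // ltW.
Qed.

Lemma expected_level_hits t :
  \sum_(k < t) \sum_s mu k s * \sum_i \sum_(y | zeros y == r) climbing_hit R (s i) y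
  <= lam%:R * (4 * n%:R * (2 * r%:R + 2)).
Proof.
pose pot s := \sum_(i < lam) hit_potential (zeros (s i)).
have pot_ge0 s : 0 <= pot s by apply: sumr_ge0 => i _; exact: hit_potential_ge0.
apply: (@le_trans _ _ (\sum_s mu 0 s * pot s)); last first.
  rewrite -[leRHS]mul1r -[X in _ <= X * _](init_sum1 R n lam) mulr_suml.
  apply: ler_sum => s _; rewrite ler_wpM2l ?init_ge0 //.
  rewrite -[X in _ <= X%:R * _]card_ord mulr_natl -sumr_const; apply: ler_sum => i _.
  exact: hit_potential_le.
apply: (@le_trans _ _ (\sum_(k < t) (\sum_s mu k s * \sum_i
    \sum_(y | zeros y == r) climbing_hit R (s i) y) + \sum_s mu t s * pot s)).
  by rewrite lerDl; apply: sumr_ge0 => s _; rewrite mulr_ge0 ?onemax_law_ge0.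
elim: t => [|t IH]; first by rewrite big_ord0 add0r.
apply: le_trans IH; rewrite big_ord_recr /= -addrA lerD2l chain_expect -big_split /=.
apply: ler_sum => s _; rewrite -mulrDr ler_wpM2l ?onemax_law_ge0 //.
apply: le_trans (lerD _ (@onemax_drift _ s hit_potential_mono)) _.
  by apply: ler_sum => i _; exact: level_hit_le.
by rewrite -big_split /= ler_sum // => i _; rewrite addrC subrK.
Qed.

Lemma expected_hits y t : zeros y = r ->
  'C(n, r)%:R * \sum_(k < t) \sum_s mu k s * \sum_i climbing_hit R (s i) y
  <= lam%:R * (4 * n%:R * (2 * r%:R + 2)).
Proof.
move=> zy; apply: le_trans (expected_level_hits t).
rewrite mulr_sumr; apply: ler_sum => k _.
apply: (@le_trans _ _ (#|[pred y : bitstr n | zeros y == r]|%:R *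
    \sum_s mu k s * \sum_i climbing_hit R (s i) y)).
  rewrite ler_wpM2r ?ler_nat ?card_level //; apply: sumr_ge0 => s _.
  by rewrite mulr_ge0 ?onemax_law_ge0 // sumr_ge0 // => i _; exact: climbing_hit_ge0.
under [leRHS]eq_bigr => s _ do rewrite exchange_big mulr_sumr.
rewrite exchange_big /= mulr_natl -sumr_const.
rewrite le_eqVlt; apply/orP; left; apply/eqP.
by apply: eq_big => // z; rewrite inE => /eqP zz; apply: expect_hit_level; rewrite zy zz.
Qed.

End Climb.

(** * Climbing without meeting a peak *)

Section Peaks.
Variables (n r : nat).
Hypothesis r2n : (2 * r <= n)%N.
Local Notation trap := (fork_trap n r).
Local Notation opt := (fork_opt n r).

Lemma zeros_trap : zeros trap = r.
Proof.
rewrite /zeros; under eq_bigr => i _ do rewrite ffunE.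
rewrite -(big_mkord xpredT (fun i => nat_of_bool (~~ (r <= i)%N))).
rewrite (@big_cat_nat _ _ _ r) //=; last lia.
rewrite (eq_big_nat _ _ (F2 := fun=> 1%N)); last first.
  by move=> i /andP[_ ir]; rewrite leqNgt ir.
rewrite sum_nat_const_nat big_nat_cond big1; first lia.
by move=> i /andP[/andP[ri _] _]; rewrite ri.
Qed.

Lemma zeros_opt : zeros opt = r.
Proof.
rewrite /zeros; under eq_bigr => i _ do rewrite ffunE.
rewrite -(big_mkord xpredT (fun i => nat_of_bool (~~ (i < n - r)%N))).
rewrite (@big_cat_nat _ _ _ (n - r)) //=; last lia.
rewrite [X in (_ + X)%N](eq_big_nat _ _ (F2 := fun=> 1%N)); last first.
  by move=> i /andP[ri _]; rewrite -leqNgt ri.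
rewrite sum_nat_const_nat big_nat_cond big1; first lia.
by move=> i /andP[/andP[_ ri] _]; rewrite ri.
Qed.

Lemma hamming_all1 (y : bitstr n) : hamming (all1 n) y = zeros y.
Proof. by apply: eq_bigr => i _; rewrite ffunE. Qed.

Lemma hamming_trap_opt : (2 * r <= hamming trap opt)%N.
Proof.
have -> : (2 * r = zeros trap + zeros opt)%N by rewrite zeros_trap zeros_opt; lia.
rewrite -big_split; apply: leq_sum => i _ /=.
by rewrite !ffunE; case: (leqP r i); case: (ltnP i (n - r)) => //; lia.
Qed.

Hypothesis r_gt0 : (0 < r)%N.

Lemma trap_neq_opt : trap != opt.
Proof.
apply/eqP => E; have := hamming_trap_opt; rewrite E /hamming big1; first lia.
by move=> i _; rewrite eqxx.
Qed.

Definition peak (y : bitstr n) := (y == trap) || (y == opt).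

Lemma peak_zeros y : peak y -> zeros y = r.
Proof. by case/orP => /eqP ->; rewrite ?zeros_trap ?zeros_opt. Qed.

Lemma all1_not_peak : ~~ peak (all1 n).
Proof.
apply/negP => /peak_zeros; have /eqP -> : zeros (all1 n) == 0%N by rewrite zeros_eq0.
by lia.
Qed.

Lemma fork_not_peak y : ~~ peak y -> fork r y = ones y.
Proof. by rewrite negb_or /fork => /andP[/negPf -> /negPf ->]. Qed.

Lemma sum_peak (R : realType) (F : bitstr n -> R) :
  \sum_(y | peak y) F y = F trap + F opt.
Proof.
rewrite (bigD1 trap) /=; last by rewrite /peak eqxx.
rewrite (bigD1 opt) /=; last by rewrite /peak eqxx orbT eq_sym trap_neq_opt.
rewrite big1 ?addr0 // => y; rewrite /peak.
by case: (y == trap) => //=; case: (y == opt).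
Qed.

End Peaks.

Section Survival.
Variables (R : realType) (n r lam tau : nat) (G : rel 'I_lam).
Hypothesis tau_gt0 : (0 < tau)%N.
Implicit Types s : popul lam n.

Lemma kernel_ge0 s s' : 0 <= Defs.kernel R r tau G s s'.
Proof. by rewrite kernelE evolve_ge0 // => x y; exact: step_ge0. Qed.

Lemma surv_ge0 t s : 0 <= surv R r tau G t s.
Proof.
elim: t s => [|t IH] s /=; case: ifP => // _; first exact: init_ge0.
by apply: sumr_ge0 => s0 _; rewrite mulr_ge0 ?kernel_ge0.
Qed.

End Survival.

Section Avoiding.
Variables (R : realType) (n lam tau r : nat) (G : rel 'I_lam).
Hypotheses (n_ge2 : (2 <= n)%N) (tau_gt0 : (0 < tau)%N) (r_gt0 : (0 < r)%N).
Hypothesis r2n : (2 * r <= n)%N.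
Implicit Types (x y v : bitstr n) (s u : popul lam n).
Local Notation q := (@GRing.inv R n%:R).
Local Notation trap := (fork_trap n r).
Local Notation opt := (fork_opt n r).
Local Notation peak := (@peak n r).
Local Notation mut := (mut_prob R).
Local Notation K1 := (@onemax_kernel R n lam tau G).
Local Notation mu := (@onemax_law R n lam tau G).

Definition avoid_step x v : R :=
  \sum_(y | ~~ peak y) mut x y * (v == sel (@ones n) x y)%:R.

Lemma avoid_step_ge0 x v : 0 <= avoid_step x v.
Proof. by apply: sumr_ge0 => y _; rewrite mulr_ge0 ?mut_ge0. Qed.

Lemma avoid_step_le x v : avoid_step x v <= step R (@ones n) x v.
Proof.
rewrite /step [leRHS](bigID peak) /= lerDr.
by apply: sumr_ge0 => y _; rewrite mulr_ge0 ?mut_ge0.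
Qed.

Lemma avoid_step_mass x : \sum_v avoid_step x v = 1 - (mut x trap + mut x opt).
Proof.
rewrite exchange_big /=.
under eq_bigr => y _ do rewrite -mulr_sumr sum_delta1 mulr1.
by rewrite -(mut_sum1 R x) [in RHS](bigID peak) /= sum_peak // addrAC subrr add0r.
Qed.

Lemma avoid_step_peak x v : ~~ peak x -> peak v -> avoid_step x v = 0.
Proof.
move=> xp up; apply: big1 => y yp; case: (eqVneq v) => [uE|_]; last by rewrite mulr0.
by move: up; rewrite uE /sel; case: ifP => _; rewrite ?(negPf yp) ?(negPf xp).
Qed.

Lemma avoid_step_le_fork x v : ~~ peak x -> avoid_step x v <= step R (fork r) x v.
Proof.
move=> xp; rewrite /step [leRHS](bigID peak) /=.
rewrite -[leLHS]add0r; apply: lerD.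
  by apply: sumr_ge0 => y _; rewrite mulr_ge0 ?mut_ge0.
by apply: ler_sum => y yp; rewrite /sel !fork_not_peak.
Qed.

Lemma avoid_step_all1 v : (1 - 2 * q ^+ r) * (v == all1 n)%:R <= avoid_step (all1 n) v.
Proof.
have [-> /=|_] := eqVneq; last by rewrite mulr0 avoid_step_ge0.
rewrite mulr1.
have mutp y : zeros y = r -> mut (all1 n) y <= q ^+ r.
  by move=> zy; rewrite mut_le_rate // hamming_all1 zy.
have avE w : w != all1 n -> avoid_step (all1 n) w = 0.
  move=> /negPf v1; apply/eqP; rewrite eq_le avoid_step_ge0 andbT.
  by have := avoid_step_le (all1 n) w; rewrite step_all1 v1.
have := avoid_step_mass (all1 n); rewrite (bigD1 (all1 n)) //= [X in _ + X]big1 ?addr0 //.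
move=> ->; have := mutp _ (zeros_trap r2n); have := mutp _ (zeros_opt r2n); lra.
Qed.

Definition climb_step x v : R :=
  if x == all1 n then (v == all1 n)%:R else avoid_step x v.

Lemma climb_step_ge0 x v : 0 <= climb_step x v.
Proof. by rewrite /climb_step; case: ifP => _; rewrite ?avoid_step_ge0. Qed.

Lemma climb_step_le x v : climb_step x v <= step R (@ones n) x v.
Proof.
rewrite /climb_step; case: eqVneq => [->|_]; first by rewrite step_all1.
exact: avoid_step_le.
Qed.

Lemma climb_step_mass x :
  \sum_v climb_step x v = 1 - (climbing_hit R x trap + climbing_hit R x opt).
Proof.
rewrite /climb_step /climbing_hit; case: eqVneq => _.
  by rewrite sum_delta1 !mul0r addr0 subr0.
by rewrite avoid_step_mass !mul1r.
Qed.

Lemma climb_step_peak x v : ~~ peak x -> peak v -> climb_step x v = 0.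
Proof.
move=> xp up; rewrite /climb_step; case: ifP => _; last exact: avoid_step_peak.
have [u1|//] := eqVneq; move: up; rewrite u1.
by have := @all1_not_peak n r r2n r_gt0; case: (peak (all1 n)).
Qed.

Definition climb_kernel := evolve tau G climb_step (@ones n).

Lemma climb_kernel_ge0 s s' : 0 <= climb_kernel s s'.
Proof. by apply: evolve_ge0 => // x y; exact: climb_step_ge0. Qed.

Lemma climb_kernel_le s s' : climb_kernel s s' <= K1 s s'.
Proof.
apply: ler_sum => u _; rewrite ler_wpM2r ?migrate_ge0 //.
by apply: ler_prod => i _; rewrite climb_step_ge0 climb_step_le.
Qed.

Definition peak_free s := [forall i, ~~ peak (s i)].

Lemma climb_kernel_peak_free s s' : peak_free s -> ~~ peak_free s' ->
  climb_kernel s s' = 0.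
Proof.
move=> /forallP sp; rewrite negb_forall => /existsP[i]; rewrite negbK => pi.
apply: big1 => u _.
have [->|/migrate_supp] := eqVneq (migrate R tau G (@ones n) u s') 0.
  by rewrite mulr0.
move=> /(_ i)[_ [j s'j]]; rewrite (bigD1 j) //= climb_step_peak ?mul0r //.
by rewrite -s'j.
Qed.

Local Notation rho := (1 - 2 * q ^+ r).

Lemma climb_kernel_le_fork s s' : peak_free s -> 2 * q ^+ r <= 1 ->
  rho ^+ lam * climb_kernel s s' <= Defs.kernel R r tau G s s'.
Proof.
move=> /forallP sp q1; rewrite kernelE mulr_sumr; apply: ler_sum => u _.
have q0 : 0 <= q ^+ r by case/andP: (rate_itv R n) => ? _; rewrite exprn_ge0.
have [/existsP[i pi]|] := boolP [exists i, peak (u i)].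
  rewrite [X in _ * (X * _)](bigD1 i) //= climb_step_peak // mul0r mul0r mulr0.
  rewrite mulr_ge0 ?migrate_ge0 //.
  by apply: prodr_ge0 => j _; exact: step_ge0.
rewrite negb_exists => /forallP up; rewrite mulrA.
rewrite (@migrate_congr _ _ _ tau G (fork r) (@ones n)); last first.
  by move=> j; rewrite fork_not_peak.
rewrite ler_wpM2r ?migrate_ge0 //.
rewrite -[X in rho ^+ X]card_ord -prodr_const -big_split /=.
apply: ler_prod => i _; rewrite mulr_ge0 ?climb_step_ge0 ?subr_ge0 //=.
apply: le_trans (avoid_step_le_fork (u i) (sp i)).
rewrite /climb_step; case: eqVneq => [->|_]; first exact: avoid_step_all1.
by rewrite ler_piMl ?avoid_step_ge0 //; lra.
Qed.

Definition climb_law := chain climb_kernel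
  (fun s => init_prob R s * (peak_free s)%:R).

Lemma climb_lawS t s :
  climb_law t.+1 s = \sum_s0 climb_law t s0 * climb_kernel s0 s.
Proof. by []. Qed.

Lemma climb_law_ge0 t s : 0 <= climb_law t s.
Proof.
by apply: chain_ge0; [exact: climb_kernel_ge0|move=> ?; rewrite mulr_ge0 ?init_ge0].
Qed.

Lemma climb_law_le t s : climb_law t s <= mu t s.
Proof.
apply: chain_le => [s1 s2|s1]; first by rewrite climb_kernel_ge0 climb_kernel_le.
rewrite mulr_ge0 ?init_ge0 //=.
by case: (peak_free s1); rewrite ?mulr1 ?mulr0 ?init_ge0.
Qed.

Lemma climb_law_peak_free t s : ~~ peak_free s -> climb_law t s = 0.
Proof.
rewrite /climb_law; elim: t s => /= [|t IH] s sp; first by rewrite (negPf sp) mulr0.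
apply: big1 => s0 _; have [s0p|s0p] := boolP (peak_free s0).
  by rewrite climb_kernel_peak_free ?mulr0.
by rewrite IH ?mul0r.
Qed.

Lemma surv_ge_climb t s : 2 * q ^+ r <= 1 ->
  rho ^+ (lam * t) * climb_law t s <= surv R r tau G t s.
Proof.
move=> q1.
have rho0 k : 0 <= rho ^+ k by rewrite exprn_ge0 // subr_ge0.
have no_opt s1 : peak_free s1 -> has_opt r s1 = false.
  move=> /forallP sp; apply/negbTE; rewrite negb_exists; apply/forallP => i.
  by have := sp i; rewrite negb_or => /andP[].
elim: t s => [|t IH] s.
  rewrite muln0 expr0 mul1r /climb_law /=; have [sp|sp] := boolP (peak_free s).
    by rewrite mulr1 no_opt.
  by rewrite mulr0; exact: (@surv_ge0 R n r lam tau G tau_gt0 0%N s).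
have [sp|sp] := boolP (peak_free s); last first.
  by rewrite climb_law_peak_free // mulr0; exact: surv_ge0.
rewrite climb_lawS /= no_opt // mulr_sumr; apply: ler_sum => s0 _.
have [s0p|s0p] := boolP (peak_free s0); last first.
  rewrite (climb_law_peak_free _ s0p) mul0r mulr0.
  by rewrite mulr_ge0 ?surv_ge0 ?kernel_ge0.
rewrite mulnS addnC exprD mulrACA ler_pM //.
- by rewrite mulr_ge0 // climb_law_ge0.
- by rewrite mulr_ge0 // climb_kernel_ge0.
- exact: climb_kernel_le_fork.
Qed.

Lemma climb_law_mass t :
  1 - \sum_s init_prob R s * (~~ peak_free s)%:R
    - \sum_(k < t) \sum_s mu k s *
        \sum_i (climbing_hit R (s i) trap + climbing_hit R (s i) opt)
  <= \sum_s climb_law t s.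
Proof.
elim: t => [|t IH].
  rewrite big_ord0 subr0 lerBlDr -big_split /= -[leLHS](init_sum1 R n lam).
  apply: ler_sum => s _; rewrite /climb_law /=.
  by case: (peak_free s); rewrite mulr1 mulr0 ?addr0 ?add0r.
rewrite big_ord_recr /= opprD addrA lerBlDr; apply: le_trans IH _.
under [X in _ <= X + _]eq_bigr => s _ do rewrite climb_lawS.
rewrite exchange_big /= -big_split /=; apply: ler_sum => s _.
rewrite -mulr_sumr evolve_mass //.
set b := \sum_i _.
have bge : 1 - b <= \prod_i \sum_y climb_step (s i) y.
  under eq_bigr => i _ do rewrite climb_step_mass.
  apply: prod_one_sub_ge => i; rewrite addr_ge0 ?climbing_hit_ge0 //=.
  rewrite -subr_ge0 -climb_step_mass; apply: sumr_ge0 => y _.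
  exact: climb_step_ge0.
apply: (@le_trans _ _ (climb_law t s * (1 - b) + climb_law t s * b)).
  by rewrite -mulrDr subrK mulr1.
rewrite lerD // ?ler_wpM2l ?climb_law_ge0 // ler_wpM2r ?climb_law_le //.
by apply: sumr_ge0 => i _; rewrite addr_ge0 ?climbing_hit_ge0.
Qed.

Definition all1_pop : popul lam n := [ffun=> all1 n].

Lemma climb_law_all1 t : \sum_s climb_law t s <=
  climb_law t all1_pop + lam%:R * n%:R * (1 - q / 4) ^+ t.
Proof.
rewrite (bigD1 all1_pop) //= lerD2l.
apply: le_trans (onemax_expected_zeros R G n_ge2 tau_gt0 t).
rewrite [leRHS](bigD1 all1_pop) //= -[leLHS]add0r; apply: lerD.
  by rewrite mulr_ge0 ?onemax_law_ge0 // sumr_ge0.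
apply: ler_sum => s s1; apply: le_trans (climb_law_le t s) _.
rewrite ler_peMr ?onemax_law_ge0 // -natr_sum ler1n lt0n sum_nat_eq0 negb_forall.
apply/existsP; have /existsP[i si] : [exists i, s i != all1 n].
  rewrite -negb_forall; apply: contraNN s1 => /forallP sE.
  by apply/eqP/ffunP => i; rewrite ffunE; apply/eqP.
by exists i; rewrite /= zeros_eq0.
Qed.

Lemma init_peak_mass :
  \sum_(s : popul lam n) init_prob R s * (~~ peak_free s)%:R
    <= 2 * lam%:R / 'C(n, r)%:R.
Proof.
have C0 : (0 < 'C(n, r))%N by rewrite bin_gt0; lia.
apply: (@le_trans _ _ (\sum_(s : popul lam n) init_prob R s *
    \sum_(i < lam) ((s i == trap)%:R + (s i == opt)%:R))).
  apply: ler_sum => s _; rewrite ler_wpM2l ?init_ge0 //.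
  have [_|] := boolP (peak_free s); first by apply: sumr_ge0 => i _; rewrite addr_ge0.
  rewrite negb_forall => /existsP[i]; rewrite negbK (bigD1 i) //= => pi.
  rewrite -[leLHS]addr0 lerD //; last by apply: sumr_ge0 => j _; rewrite addr_ge0.
  by case/orP: pi => ->; rewrite ?lerDl ?lerDr.
under eq_bigr => s _ do rewrite mulr_sumr.
rewrite exchange_big /=.
under eq_bigr => i _ do under eq_bigr => s _ do rewrite mulrDr.
under eq_bigr => i _ do rewrite big_split /= !init_marginal.
rewrite sumr_const card_ord -[_ *+ lam]mulr_natl.
have h : ((2 ^ n)%:R^-1 : R) <= 'C(n, r)%:R^-1.
  by rewrite lef_pV2 ?posrE ?ltr0n ?expn_gt0 // ler_nat bin_le_exp2.
apply: le_trans (ler_wpM2l _ (lerD h h)) _; first exact: ler0n.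
by rewrite le_eqVlt; apply/orP; left; apply/eqP; ring.
Qed.

Lemma surv_all1_ge t : 2 * q ^+ r <= 1 ->
  rho ^+ (lam * t) * (1 - 2 * lam%:R / 'C(n, r)%:R * (1 + 4 * n%:R * (2 * r%:R + 2))
      - lam%:R * n%:R * (1 - q / 4) ^+ t)
  <= surv R r tau G t all1_pop.
Proof.
move=> q1; apply: le_trans (surv_ge_climb t all1_pop q1).
rewrite ler_wpM2l ?exprn_ge0 ?subr_ge0 //.
have C0 : (0 : R) < 'C(n, r)%:R by rewrite ltr0n bin_gt0; lia.
have hits y : zeros y = r -> \sum_(k < t) \sum_s mu k s * \sum_i climbing_hit R (s i) y
    <= lam%:R / 'C(n, r)%:R * (4 * n%:R * (2 * r%:R + 2)).
  move=> zy; rewrite mulrAC ler_pdivlMr // mulrC.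
  exact: expected_hits.
have := hits _ (zeros_trap r2n); have := hits _ (zeros_opt r2n).
have := climb_law_mass t; have := climb_law_all1 t; have := init_peak_mass.
under [X in _ - X <= _ -> _]eq_bigr => k _ do
  under eq_bigr => s _ do rewrite big_split mulrDr.
under [X in _ - X <= _ -> _]eq_bigr => k _ do rewrite big_split.
rewrite big_split /=.
rewrite -[2 * lam%:R / _]mulrA; set cc := lam%:R / _; set dd := 4 * n%:R * _.
lra.
Qed.

End Avoiding.

(** * The race between trap and optimum *)

Section PotentialBound.
Variables (R : realType) (n r lam tau : nat) (G : rel 'I_lam).
Hypothesis tau_gt0 : (0 < tau)%N.
Implicit Types s : popul lam n.
Local Notation K := (@Defs.kernel R n r lam tau G).
Local Notation sv := (@surv R n r lam tau G).
Local Notation prob := (@prob_T_gt R n r lam tau G).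

Lemma prob_T_gt_ge0 t : 0 <= prob t.
Proof. by apply: sumr_ge0 => s _; exact: surv_ge0. Qed.

Variable h : popul lam n -> R.
Hypotheses (h_ge0 : forall s, 0 <= h s) (h_opt : forall s, has_opt r s -> h s = 0).
Hypothesis h_drift : forall s, h s <= 1 + \sum_s' K s s' * h s'.

Lemma potential_step t :
  \sum_s sv t s * h s <= prob t + \sum_s sv t.+1 s * h s.
Proof.
have -> : \sum_s sv t.+1 s * h s = \sum_s sv t s * \sum_s' K s s' * h s'.
  transitivity (\sum_s \sum_s0 sv t s0 * K s0 s * h s).
    apply: eq_bigr => s _ /=; case: ifP => [/h_opt ->|_]; last by rewrite mulr_suml.
    by rewrite mulr0 big1 // => s0 _; rewrite mulr0.
  rewrite exchange_big /=; apply: eq_bigr => s0 _.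
  by rewrite mulr_sumr; apply: eq_bigr => s _; rewrite mulrA.
rewrite -big_split /=; apply: ler_sum => s _.
by rewrite -{2}[sv t s]mulr1 -mulrDr ler_wpM2l ?surv_ge0.
Qed.

Lemma potential_iter t k :
  \sum_s sv t s * h s <=
  \sum_(j < k) prob (t + j) + \sum_s sv (t + k)%N s * h s.
Proof.
elim: k => [|k IH]; first by rewrite big_ord0 add0r addn0.
apply: le_trans IH _; rewrite big_ord_recr /= -addrA lerD2l addnS.
exact: potential_step.
Qed.

Lemma partial_sum_le_expected (N : nat) :
  ((\sum_(k < N) prob k)%:E <= expected_T R n r tau G)%E.
Proof.
rewrite -sumEFin -(big_mkord xpredT (fun k => (prob k)%:E)).
by apply: nneseries_lim_ge => k _ _; rewrite lee_fin prob_T_gt_ge0.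
Qed.

(* If [E T] is finite then [Pr(T > t)] cannot stay bounded away from [0], so the
   boundary term of [potential_iter] disappears in the limit. *)
Lemma potential_le_expected t :
  ((\sum_s sv t s * h s)%:E <= expected_T R n r tau G)%E.
Proof.
have tail k : ((\sum_(j < k) prob (t + j))%:E <= expected_T R n r tau G)%E.
  apply: le_trans (partial_sum_le_expected (t + k)); rewrite lee_fin.
  rewrite big_split_ord /= lerDr; apply: sumr_ge0 => j _.
  exact: prob_T_gt_ge0.
case E: (expected_T R n r tau G) => [e| |]; last 2 first.
- by rewrite leey.
- by have := tail 0%N; rewrite E big_ord0.
rewrite lee_fin leNgt; apply/negP => eX.
set X := \sum_s _ in eX.
pose H := 1 + \sum_s h s.
have H1 : 1 <= H by rewrite lerDl; apply: sumr_ge0.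
have hH s : h s <= H.
  rewrite /H (bigD1 s) //= addrCA lerDl addr_ge0 // sumr_ge0 //.
have big k : (X - e) / H <= prob (t + k).
  rewrite ler_pdivrMr; last lra.
  have := tail k; rewrite E lee_fin => tk.
  have := potential_iter t k; rewrite -/X => Xk.
  have : \sum_s sv (t + k)%N s * h s <= prob (t + k) * H.
    rewrite mulr_suml; apply: ler_sum => s _.
    by rewrite ler_wpM2l ?surv_ge0.
  lra.
pose d := (X - e) / H.
have d0 : 0 < d by rewrite divr_gt0 //; lra.
pose N := Num.bound (e / d).
have e0 : 0 <= e by have := tail 0%N; rewrite E big_ord0 lee_fin.
have eN : e < N%:R * d.
  by rewrite -ltr_pdivrMr //; apply: archi_boundP; rewrite divr_ge0 // ltW.
have := tail N; rewrite E lee_fin leNgt => /negP; apply.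
apply: lt_le_trans eN _; rewrite -{1}[N]card_ord mulr_natl -sumr_const.
by apply: ler_sum => k _; exact: big.
Qed.

End PotentialBound.

Lemma exprD_ge_linear (R : realType) (a p : R) k : 0 <= a <= 1 -> 0 <= p ->
  a ^+ k + k%:R * p * a ^+ k <= (a + p) ^+ k.
Proof.
move=> /andP[a0 a1] p0; elim: k => [|k IH]; first by rewrite !mul0r addr0.
rewrite !exprS; apply: le_trans (ler_wpM2l _ IH); last exact: addr_ge0.
have b0 : 0 <= a ^+ k by exact: exprn_ge0.
have k0 : 0 <= k%:R :> R by exact: ler0n.
rewrite -natr1; set b := a ^+ k in b0 *; set m := k%:R in k0 *.
have : 0 <= p * b * (1 - a) by rewrite !mulr_ge0 // subr_ge0.
have : 0 <= m * p * p * b by rewrite !mulr_ge0.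
nra.
Qed.

Section TwoPeaks.
Variables (R : realType) (n r lam tau : nat).
Hypotheses (n_ge2 : (2 <= n)%N) (tau_gt0 : (0 < tau)%N) (r_gt0 : (0 < r)%N).
Hypotheses (r2n : (2 * r <= n)%N) (lam_gt0 : (0 < lam)%N).
Implicit Types (x y v : bitstr n) (s u : popul lam n).
Local Notation q := (@GRing.inv R n%:R).
Local Notation trap := (fork_trap n r).
Local Notation opt := (fork_opt n r).
Local Notation one := (all1 n).
Local Notation Q := (step R (fork r)).
Local Notation G := (complete_graph lam).
Local Notation K := (@Defs.kernel R n r lam tau G).
Local Notation eps := (lam%:R * q ^+ r).
Local Notation all1_pop := (all1_pop n lam).

Lemma trap_neq_all1 : trap != one.
Proof.
apply/eqP => E; have := all1_not_peak r2n r_gt0.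
by rewrite -E /peak eqxx.
Qed.

Lemma opt_neq_all1 : opt != one.
Proof.
apply/eqP => E; have := all1_not_peak r2n r_gt0.
by rewrite -E /peak eqxx orbT.
Qed.

Lemma fork_trap_val : fork r trap = n.+1.
Proof. by rewrite /fork (negPf (trap_neq_opt r2n r_gt0)) eqxx addn1. Qed.

Lemma fork_all1_val : fork r one = n.
Proof.
rewrite fork_not_peak ?all1_not_peak //.
have /eqP z0 : zeros one == 0%N by rewrite zeros_eq0.
by have := ones_zeros one; rewrite z0 addn0.
Qed.

Lemma fork_lt_trap y : y != opt -> y != trap -> (fork r y < n.+1)%N.
Proof.
move=> /negPf yo /negPf yt; rewrite /fork yo yt ltnS.
by have := ones_zeros y; lia.
Qed.

Lemma step_trap_trap : 1 - q ^+ (2 * r) <= Q trap trap.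
Proof.
apply: (@le_trans _ _ (1 - mut_prob R trap opt)).
  by rewrite lerD2l lerN2 mut_le_rate // hamming_trap_opt.
rewrite -[X in X - _](mut_sum1 R trap) (bigD1 opt) //= addrAC subrr add0r.
rewrite /step [leRHS](bigD1 opt) //= -[leLHS]add0r; apply: lerD.
  by rewrite mulr_ge0 ?mut_ge0.
apply: ler_sum => y yo; have -> : sel (fork r) trap y = trap.
  rewrite /sel; case: ifP => //; have [//|yt] := eqVneq y trap.
  by rewrite fork_trap_val leqNgt fork_lt_trap.
by rewrite eqxx mulr1.
Qed.

Lemma step_all1_all1 : 1 - 2 * q ^+ r <= Q one one.
Proof.
apply: le_trans (avoid_step_le_fork R _ _); last exact: all1_not_peak.
by have := avoid_step_all1 R r_gt0 r2n one; rewrite eqxx mulr1.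
Qed.

Lemma step_all1_trap : q ^+ r / 4 <= Q one trap.
Proof.
apply: (@le_trans _ _ (mut_prob R one trap)).
  have := mut_ge_rate R one trap n_ge2.
  by rewrite hamming_all1 zeros_trap.
rewrite /step (bigD1 trap) //= /sel fork_all1_val fork_trap_val leqnSn eqxx mulr1.
by rewrite lerDl; apply: sumr_ge0 => y _; rewrite mulr_ge0 ?mut_ge0.
Qed.

Definition two_peaks s := [forall i, (s i == one) || (s i == trap)].
Definition trap_pop : popul lam n := [ffun=> trap].

Lemma mig_to_trap u i k y : two_peaks u -> u k = trap ->
  mig_weight R G (fork r) u i y != 0 -> y = trap.
Proof.
move=> /forallP u2 uk yw; have [fy [j yj]] := mig_weight_supp yw.
case/orP: (u2 j); rewrite -yj => /eqP // y1.
case/orP: (u2 i) => /eqP ui; last first.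
  by move: fy; rewrite ui y1 fork_all1_val fork_trap_val ltnn.
move: yw; rewrite /mig_weight.
have kN : k \in [set j | G i j].
  rewrite inE; apply: contraTN trap_neq_all1 => /eqP ik.
  by rewrite -uk -ik ui eqxx.
case: ifP => [/eqP N0|_]; first by rewrite N0 inE in kN.
rewrite [X in _ * X]big1 ?mulr0 ?eqxx // => l; rewrite inE => /andP[_ /eqP lm].
have fl : (fork r trap <= fork r (u l))%N.
  by rewrite lm -uk; apply: (@leq_bigmax_cond _ _ (fun j => fork r (u j))).
case/orP: (u2 l) => /eqP ul.
  by move: fl; rewrite ul fork_all1_val fork_trap_val ltnn.
rewrite y1 ui ul /sel fork_all1_val fork_trap_val leqnSn.
by rewrite eq_sym (negPf trap_neq_all1).
Qed.

(* [hD], [hB] and [hA] bound from below the expected remaining time when all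
   islands are trapped, when some are, and when all hold [1^n]. *)
Definition hD : R := (lam%:R * q ^+ (2 * r))^-1.
Definition hB : R := (tau%:R + hD / 2) / (1 + 2 * tau%:R * eps).
Definition hA : R := (1 + eps / 8 * hB) / (2 * eps).

Definition pot s : R :=
  if s == trap_pop then hD
  else if s == all1_pop then hA
  else if two_peaks s then hB else 0.

Hypothesis eps_small : eps <= 4^-1.

Lemma rate_pow_itv k : 0 < q ^+ k <= 1.
Proof.
have /andP[q0 q1] := rate_itv R n.
by rewrite exprn_gt0 ?invr_gt0 ?ltr0n 1?ltnW //= exprn_ile1.
Qed.

Lemma eps_gt0 : 0 < eps.
Proof. by rewrite mulr_gt0 ?ltr0n //; case/andP: (rate_pow_itv r). Qed.

Lemma rate_le_eps : q ^+ r <= eps.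
Proof.
by rewrite ler_peMl ?ler1n //; case/andP: (rate_pow_itv r) => /ltW.
Qed.

Lemma hD_gt0 : 0 < hD.
Proof. by rewrite invr_gt0 mulr_gt0 ?ltr0n //; case/andP: (rate_pow_itv (2 * r)). Qed.

Lemma hB_den_gt0 : 0 < 1 + 2 * tau%:R * eps.
Proof.
have t0 : 0 < tau%:R :> R by rewrite ltr0n.
by apply: addr_gt0 => //; apply: mulr_gt0 eps_gt0; exact: mulr_gt0.
Qed.

Lemma hB_gt0 : 0 < hB.
Proof.
apply: divr_gt0 hB_den_gt0; rewrite addr_gt0 ?ltr0n //.
by rewrite divr_gt0 ?hD_gt0.
Qed.

Lemma hA_gt0 : 0 < hA.
Proof.
have e0 := eps_gt0; have b0 := hB_gt0.
apply: divr_gt0; last exact: mulr_gt0.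
by apply: addr_gt0 => //; apply: mulr_gt0 => //; exact: divr_gt0.
Qed.

Lemma hB_eq : hB * (1 + 2 * tau%:R * eps) = tau%:R + hD / 2.
Proof. by rewrite divfK // gt_eqF // hB_den_gt0. Qed.

Lemma hB_le_hD : hB <= hD.
Proof.
have t0 : 0 < tau%:R :> R by rewrite ltr0n.
have e0 := eps_gt0; have d0 := hD_gt0.
rewrite ler_pdivrMr ?hB_den_gt0 //.
have : 1 <= hD * eps.
  have /andP[q0 q1] := rate_pow_itv r.
  have l0 : 0 < lam%:R :> R by rewrite ltr0n.
  rewrite /hD mulnC exprM expr2 mulrC ler_pdivlMr ?mulr_gt0 // mul1r.
  by rewrite mulrA ler_piMr // ltW // mulr_gt0.
move=> de; have : tau%:R <= tau%:R * (hD * eps) by rewrite ler_peMr // ltW.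
lra.
Qed.

Lemma pot_ge0 s : 0 <= pot s.
Proof.
rewrite /pot; case: ifP => _; first exact: ltW hD_gt0.
case: ifP => _; first exact: ltW hA_gt0.
by case: ifP => // _; exact: ltW hB_gt0.
Qed.

Lemma pot_trapped s : two_peaks s -> s != all1_pop -> hB <= pot s.
Proof.
rewrite /pot => -> /negPf ->; case: ifP => // _; exact: hB_le_hD.
Qed.

Lemma pot_all1 : pot all1_pop = hA.
Proof.
rewrite /pot eqxx; case: eqP => // /ffunP/(_ (Ordinal lam_gt0)).
by rewrite !ffunE => /eqP; rewrite eq_sym (negPf trap_neq_all1).
Qed.

Lemma pot_opt s : has_opt r s -> pot s = 0.
Proof.
case/existsP => i /eqP si; rewrite /pot.
have ot := trap_neq_opt r2n r_gt0; have o1 := opt_neq_all1.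
case: eqP => [sE|_]; first by move: si ot; rewrite sE ffunE => ->; rewrite eqxx.
case: eqP => [sE|_]; first by move: si o1; rewrite sE ffunE => ->; rewrite eqxx.
case: ifP => // /forallP/(_ i); rewrite si (negPf o1) /= eq_sym => /eqP E.
by move: ot; rewrite E eqxx.
Qed.

Local Notation mig_pot u := (\sum_s' migrate R tau G (fork r) u s' * pot s').

Lemma mig_pot_ge0 u : 0 <= mig_pot u.
Proof. by apply: sumr_ge0 => s _; rewrite mulr_ge0 ?migrate_ge0 ?pot_ge0. Qed.

Lemma mig_pot_const x : pot [ffun=> x] <= mig_pot [ffun=> x].
Proof.
apply: migrate_expect_ge => // s' s'E; rewrite [s'](_ : _ = [ffun=> x]) //.
by apply/ffunP => i; have [_ [j ->]] := s'E i; rewrite !ffunE.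
Qed.

Lemma mig_pot_trapped u : two_peaks u -> u != all1_pop ->
  (1 - tau%:R^-1) * hB + tau%:R^-1 * hD <= mig_pot u.
Proof.
move=> u2 u1; have /andP[t0 t1] := flag_itv R tau_gt0.
have [k uk] : exists k, u k = trap.
  have /existsP[k uk] : [exists k, u k != one].
    rewrite -negb_forall; apply: contraNN u1 => /forallP uE.
    by apply/eqP/ffunP => i; rewrite ffunE; apply/eqP.
  by exists k; have /forallP/(_ k) := u2; rewrite (negPf uk) /= => /eqP.
rewrite /migrate; under eq_bigr => s' _ do rewrite mulrDl -!mulrA.
rewrite big_split /= -!mulr_sumr sum_delta; apply: lerD.
  by rewrite ler_wpM2l ?subr_ge0 // pot_trapped.
rewrite ler_wpM2l //.
have W : \sum_(s' : popul lam n) \prod_i mig_weight R G (fork r) u i (s' i) = 1.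
  by rewrite sum_prod_ffun big1 // => i _; exact: mig_weight_sum1.
rewrite -[leLHS]mul1r -[X in X * _ <= _]W mulr_suml; apply: ler_sum => s' _.
have [->|sE] := eqVneq s' trap_pop; first by rewrite /pot eqxx.
have /existsP[i si] : [exists i, s' i != trap].
  rewrite -negb_forall; apply: contraNN sE => /forallP sE.
  by apply/eqP/ffunP => i; rewrite ffunE; apply/eqP.
rewrite (bigD1 i) //=; suff -> : mig_weight R G (fork r) u i (s' i) = 0 by rewrite !mul0r.
apply/eqP; apply: contraNT si => /(mig_to_trap u2 uk) ->; exact: eqxx.
Qed.

Lemma mig_pot_trapped_hB u : two_peaks u -> u != all1_pop -> hB <= mig_pot u.
Proof.
move=> u2 u1; apply: le_trans (mig_pot_trapped u2 u1).
have /andP[t0 t1] := flag_itv R tau_gt0; have := hB_le_hD.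
have hb := hB_gt0; nra.
Qed.

Lemma kernel_pot_ge (F : 'I_lam -> bitstr n -> R) s (c : popul lam n -> R) :
  (forall i v, 0 <= F i v <= Q (s i) v) ->
  (forall u, (forall i, F i (u i) != 0) -> c u <= mig_pot u) ->
  \sum_(u : popul lam n) (\prod_i F i (u i)) * c u <= \sum_s' K s s' * pot s'.
Proof.
move=> FQ cm; under [leRHS]eq_bigr => s' _ do rewrite kernelE.
rewrite evolve_expect; apply: ler_sum => u _.
have [/forallP Fu|] := boolP [forall i, F i (u i) != 0]; last first.
  rewrite negb_forall => /existsP[i]; rewrite negbK (bigD1 i) //= => /eqP ->.
  rewrite !mul0r mulr_ge0 ?mig_pot_ge0 //; apply: prodr_ge0 => j _.
  exact: step_ge0.
apply: (@le_trans _ _ ((\prod_i F i (u i)) * mig_pot u)).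
  rewrite ler_wpM2l ?cm //; apply: prodr_ge0 => i _.
  by case/andP: (FQ i (u i)).
by rewrite ler_wpM2r ?mig_pot_ge0 // ler_prod.
Qed.

Lemma pot_drift_trap : hD <= 1 + \sum_s' K trap_pop s' * pot s'.
Proof.
have d0 := hD_gt0; have /andP[q0 q1] := rate_pow_itv (2 * r).
pose F (i : 'I_lam) v : R := (v == trap)%:R * (1 - q ^+ (2 * r)).
have := @kernel_pot_ge F trap_pop (fun=> hD).
rewrite -mulr_suml sum_prod_ffun.
under eq_bigr => i _ do rewrite -mulr_suml sum_delta1 mul1r.
rewrite prodr_const card_ord => H.
apply: (@le_trans _ _ (1 + (1 - q ^+ (2 * r)) ^+ lam * hD)).
  have := @bernoulli_ge R (q ^+ (2 * r)) lam; rewrite (ltW q0) q1 => /(_ isT) B.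
  have : (lam%:R * q ^+ (2 * r)) * hD = 1.
    by rewrite /hD divff // gt_eqF // mulr_gt0 ?ltr0n.
  nra.
rewrite lerD2l; apply: H => [i v|u Fu].
  rewrite /F ffunE; have [->|_] := eqVneq v; last by rewrite mul0r lexx step_ge0.
  by rewrite mul1r subr_ge0 q1 step_trap_trap.
have -> : u = trap_pop.
  apply/ffunP => i; rewrite ffunE; have := Fu i; rewrite /F.
  by case: (eqVneq (u i) trap) => // _; rewrite mul0r eqxx.
by apply: le_trans (mig_pot_const trap); rewrite /pot eqxx.
Qed.

Lemma pot_drift_mixed s : two_peaks s -> s != all1_pop ->
  hB <= 1 + \sum_s' K s s' * pot s'.
Proof.
move=> s2 s1; have /andP[q0 q1] := rate_pow_itv r.
have e0 := eps_gt0; have d0 := hD_gt0; have b0 := hB_gt0; have bd := hB_le_hD.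
have es := eps_small.
have /andP[t0 t1] := flag_itv R tau_gt0.
pose F (i : 'I_lam) v : R := (v == s i)%:R * (1 - 2 * q ^+ r).
have qe := rate_le_eps.
set c := (1 - tau%:R^-1) * hB + tau%:R^-1 * hD.
have := @kernel_pot_ge F s (fun=> c).
rewrite -mulr_suml sum_prod_ffun.
under eq_bigr => i _ do rewrite -mulr_suml sum_delta1 mul1r.
rewrite prodr_const card_ord => H.
apply: (@le_trans _ _ (1 + (1 - 2 * q ^+ r) ^+ lam * c)).
  have q2 : 0 <= 2 * q ^+ r <= 1 by apply/andP; split; lra.
  have B := bernoulli_ge lam q2.
  have c0 : 0 <= c by rewrite addr_ge0 // mulr_ge0 ?subr_ge0 // ltW.
  have : (1 - 2 * eps) * c <= (1 - 2 * q ^+ r) ^+ lam * c.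
    by rewrite ler_wpM2r //; apply: le_trans B; rewrite mulrCA.
  suff : hB <= 1 + (1 - 2 * eps) * c by lra.
  have tE : tau%:R * tau%:R^-1 = 1 :> R by rewrite divff // pnatr_eq0 -lt0n.
  have E : tau%:R^-1 * (hB * (1 + 2 * tau%:R * eps)) =
           tau%:R^-1 * (tau%:R + hD / 2) by rewrite hB_eq.
  have E2 : tau%:R^-1 * hB + 2 * eps * hB = 1 + tau%:R^-1 * hD / 2.
    transitivity (tau%:R^-1 * (hB * (1 + 2 * tau%:R * eps))).
      have -> : tau%:R^-1 * (hB * (1 + 2 * tau%:R * eps)) =
        tau%:R^-1 * hB + (tau%:R * tau%:R^-1) * (2 * eps * hB) by ring.
      by rewrite tE mul1r.
    by rewrite E mulrDr [X in X + _]mulrC tE mulrA.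
  have : 0 <= tau%:R^-1 * eps * hB.
    by apply: mulr_ge0 (ltW b0); apply: mulr_ge0 (ltW e0).
  have : tau%:R^-1 * hD * (2 * eps) <= tau%:R^-1 * hD * 2^-1.
    by rewrite ler_wpM2l ?mulr_ge0 ?(ltW d0) //; lra.
  rewrite /c; set w := tau%:R^-1 in E2 *.
  have -> : (1 - 2 * eps) * ((1 - w) * hB + w * hD) =
    hB - (w * hB + 2 * eps * hB) + w * hD + 2 * (w * eps * hB)
    - w * hD * (2 * eps) by ring.
  rewrite E2; lra.
rewrite lerD2l; apply: H => [i v|u Fu].
  rewrite /F; have [->|_] := eqVneq v; last by rewrite mul0r lexx step_ge0.
  rewrite mul1r subr_ge0; apply/andP; split; first by lra.
  have /forallP/(_ i)/orP[/eqP ->|/eqP ->] := s2; first exact: step_all1_all1.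
  apply: le_trans step_trap_trap.
  have /andP[_ q2] := rate_pow_itv r.
  by rewrite mulnC exprM expr2; nra.
have -> : u = s.
  apply/ffunP => i; have := Fu i; rewrite /F.
  by case: (eqVneq (u i) (s i)) => // _; rewrite mul0r eqxx.
exact: mig_pot_trapped.
Qed.

Lemma pot_drift_all1 : hA <= 1 + \sum_s' K all1_pop s' * pot s'.
Proof.
have /andP[q0 q1] := rate_pow_itv r; have qe := rate_le_eps.
have e0 := eps_gt0; have b0 := hB_gt0; have a0 := hA_gt0.
have es := eps_small.
pose a : R := 1 - 2 * q ^+ r; pose p : R := q ^+ r / 4.
have a01 : 0 <= a <= 1 by apply/andP; rewrite /a; split; lra.
have p0 : 0 <= p by rewrite /p; lra.
pose F (i : 'I_lam) v : R := (v == one)%:R * a + (v == trap)%:R * p.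
pose c u : R := hB + (u == all1_pop)%:R * (hA - hB).
have H := @kernel_pot_ge F all1_pop c.
have F1 : F ^~ one =1 fun=> a.
  by move=> i; rewrite /F eqxx eq_sym (negPf trap_neq_all1) mul1r mul0r addr0.
have sumE : \sum_(u : popul lam n) (\prod_i F i (u i)) * c u
    = (a + p) ^+ lam * hB + a ^+ lam * (hA - hB).
  under eq_bigr => u _ do rewrite mulrDr [X in _ + X]mulrCA.
  rewrite big_split /= -mulr_suml sum_prod_ffun sum_delta; congr (_ * _ + _ * _).
    rewrite -[in RHS](card_ord lam) -prodr_const; apply: eq_bigr => i _.
    by rewrite big_split /= -!mulr_suml !sum_delta1 !mul1r.
  rewrite -[in RHS](card_ord lam) -prodr_const; apply: eq_bigr => i _.
  by rewrite ffunE F1.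
apply: le_trans (_ : 1 + ((a + p) ^+ lam * hB + a ^+ lam * (hA - hB)) <= _).
  have q2 : 0 <= 2 * q ^+ r <= 1 by apply/andP; split; lra.
  have B : 1 - 2 * eps <= a ^+ lam.
    by have := bernoulli_ge lam q2; rewrite mulrCA.
  have P := exprD_ge_linear lam a01 p0.
  have hAE : hA * (2 * eps) = 1 + eps / 8 * hB.
    by rewrite divfK // gt_eqF // mulr_gt0.
  have : eps / 8 <= lam%:R * p * a ^+ lam.
    have -> : eps / 8 = lam%:R * p * 2^-1 by rewrite /p; field.
    by rewrite ler_wpM2l ?mulr_ge0 //; lra.
  move=> P2; have P3 : eps / 8 * hB <= ((a + p) ^+ lam - a ^+ lam) * hB.
    by rewrite ler_wpM2r ?(ltW b0) //; lra.
  have : (1 - 2 * eps) * hA <= a ^+ lam * hA by rewrite ler_wpM2r // ltW.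
  lra.
rewrite lerD2l -sumE; apply: H => [i v|u Fu].
  rewrite ffunE; have [->|v1] := eqVneq v one.
    by rewrite F1 step_all1_all1; case/andP: a01 => ->.
  rewrite /F (negPf v1) mul0r add0r.
  have [->|_] := eqVneq v trap; last by rewrite mul0r lexx step_ge0.
  by rewrite mul1r p0 step_all1_trap.
have u2 : two_peaks u.
  apply/forallP => i; have := Fu i; rewrite /F; apply: contraNT.
  by rewrite negb_or => /andP[/negPf -> /negPf ->]; rewrite !mul0r addr0.
rewrite /c; have [->|u1] := eqVneq u all1_pop.
  by rewrite mul1r addrC subrK -pot_all1; exact: mig_pot_const.
by rewrite mul0r addr0; exact: mig_pot_trapped_hB.
Qed.

Lemma pot_drift s : pot s <= 1 + \sum_s' K s s' * pot s'.
Proof.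
have ge1 : 0 <= 1 + \sum_s' K s s' * pot s'.
  by rewrite addr_ge0 // sumr_ge0 // => s' _; rewrite mulr_ge0 ?kernel_ge0 ?pot_ge0.
rewrite {1}/pot; have [->|_] := eqVneq s trap_pop; first exact: pot_drift_trap.
have [->|s1] := eqVneq s all1_pop; first exact: pot_drift_all1.
by case: ifP => // s2; exact: pot_drift_mixed.
Qed.

Lemma expected_T_ge t :
  ((surv R r tau G t all1_pop * hA)%:E <= expected_T R n r tau G)%E.
Proof.
apply: le_trans (potential_le_expected tau_gt0 pot_ge0 pot_opt pot_drift t).
rewrite lee_fin (bigD1 all1_pop) //= pot_all1 lerDl sumr_ge0 // => s _.
by rewrite mulr_ge0 ?surv_ge0 ?pot_ge0.
Qed.

End TwoPeaks.

(** * Asymptotics *)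

Lemma expn_le_bin (n r : nat) : (2 * r <= n)%N ->
  (n ^ r <= 2 ^ r * r`! * 'C(n, r))%N.
Proof.
move=> r2n; rewrite -mulnA [(r`! * _)%N]mulnC bin_ffact.
have le_ffact k : (k <= r)%N -> (n ^ k <= 2 ^ k * n ^_ k)%N.
  elim: k => [//|k IH] kr; rewrite !expnSr ffactnSr mulnACA.
  by apply: leq_mul; [apply: IH; lia|lia].
exact: le_ffact.
Qed.

Lemma target_le_hA (R : realType) (n r lam tau : nat) :
  (0 < n)%N -> (0 < lam)%N -> (0 < tau)%N ->
  (n%:R ^+ (3 * r) + tau%:R * lam%:R * n%:R ^+ r)
    / (lam%:R * n%:R ^+ r + tau%:R * lam%:R ^+ 2) <= 64 * hA R n r lam tau.
Proof.
move=> n0 l0 t0; rewrite /hA /hB /hD.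
have B0 : (0 : R) < n%:R ^+ r by rewrite exprn_gt0 // ltr0n.
have A0 : (0 : R) < lam%:R by rewrite ltr0n.
have T0 : (0 : R) < tau%:R by rewrite ltr0n.
have -> : (n%:R ^+ (3 * r) : R) = (n%:R ^+ r) ^+ 3 by rewrite -exprM mulnC.
have -> : (n%:R^-1 ^+ (2 * r) : R) = ((n%:R ^+ r) ^+ 2)^-1.
  by rewrite exprVn -exprM mulnC.
rewrite exprVn.
set B := n%:R ^+ r in B0 *; set A := lam%:R in A0 *; set T := tau%:R in T0 *.
have AB0 : 0 < A / B by exact: divr_gt0.
pose D := (A / B ^+ 2)^-1; rewrite -/D.
have D0 : 0 < D by rewrite invr_gt0 divr_gt0 // exprn_gt0.
have TAB : 0 < T * (A / B) by exact: mulr_gt0.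
have -> : (B ^+ 3 + T * A * B) / (A * B + T * A ^+ 2) = (D + T) / (1 + T * (A / B)).
  rewrite /D; have TA := mulr_gt0 T0 A0; have TAA := mulr_gt0 TA A0.
  have AB := mulr_gt0 A0 B0.
  by field; rewrite !gt_eqF //; nra.
set E := T * (A / B) in TAB *.
have -> : 2 * T * (A / B) = 2 * E by rewrite /E; ring.
set e := A / B in AB0 *; set b := (T + D / 2) / (1 + 2 * E).
have le_b : (D + T) / (1 + E) <= 4 * b.
  rewrite ler_pdivrMr; last lra.
  rewrite /b mulrA mulrAC ler_pdivlMr; last lra.
  nra.
have -> : 64 * ((1 + e / 8 * b) / (2 * e)) = 32 / e + 4 * b.
  by field; rewrite gt_eqF.
have : 0 < 32 / e by exact: divr_gt0.
lra.
Qed.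

Lemma one_sub_ge_expR (R : realType) (x : R) : 0 <= x <= 4^-1 ->
  expR (- (4 * x)) <= 1 - 2 * x.
Proof.
move=> /andP[x0 x1]; rewrite expRN.
have e1 := expR_ge1Dx (4 * x); have e0 := expR_gt0 (4 * x).
rewrite -[leLHS]mul1r ler_pdivrMr //.
have : (1 - 2 * x) * (1 + 4 * x) <= (1 - 2 * x) * expR (4 * x).
  by rewrite ler_wpM2l //; lra.
nra.
Qed.

Section Constants.
Variables (R : realType) (n r lam : nat).
Hypothesis n4 : (4 <= n)%N.
Local Notation q := (@GRing.inv R n%:R).
Local Notation eps := (lam%:R * q ^+ r).
Local Notation l := (@ln R n%:R).

Let n_gt0 : 0 < n%:R :> R.
Proof. by rewrite ltr0n (leq_trans _ n4). Qed.

Lemma climb_failure_le (t : nat) : eps <= 4^-1 ->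
  4 * n%:R * (r%:R + 2) * l <= t%:R ->
  lam%:R * n%:R * (1 - q / 4) ^+ t <= 4^-1.
Proof.
move=> eps4 xt.
have q0 : 0 < q by rewrite invr_gt0.
have q4 : q <= 4^-1 by rewrite lef_pV2 ?posrE // ler_nat.
have le_exp : (1 - q / 4) ^+ t <= (n%:R ^+ r.+2)^-1.
  apply: (@le_trans _ _ (expR (- (q / 4)) ^+ t)).
    by rewrite lerXn2r ?nnegrE ?expR_ge0 ?expR_ge1Dx //; lra.
  rewrite -expRM_natl -[X in X ^+ _](@lnK R) ?posrE // -expRM_natl -expRN ler_expR.
  rewrite mulrN lerN2 -addn2 natrD.
  have -> : (r%:R + 2) * l = 4 * n%:R * (r%:R + 2) * l * (q / 4).
    by field; rewrite gt_eqF.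
  by rewrite ler_wpM2r // divr_ge0 // ltW.
apply: le_trans (ler_wpM2l _ le_exp) _; first by rewrite mulr_ge0.
have -> : lam%:R * n%:R * (n%:R ^+ r.+2)^-1 = eps * q.
  by rewrite exprVn !exprS; field; rewrite !gt_eqF ?exprn_gt0.
have eps0 : 0 <= eps by rewrite mulr_ge0 // exprn_ge0 // ltW.
by apply: le_trans eps4; rewrite ler_piMr //; lra.
Qed.

Lemma peak_hits_le : (2 * r <= n)%N ->
  8 * (2 ^ r * r`!)%:R * (8 * r%:R + 9) * (eps * n%:R) <= 1 ->
  2 * lam%:R / 'C(n, r)%:R * (1 + 4 * n%:R * (2 * r%:R + 2)) <= 4^-1 :> R.
Proof.
move=> r2n; set kb := (2 ^ r * r`!)%:R => epsn.
have c0 : (0 : R) < 'C(n, r)%:R by rewrite ltr0n bin_gt0; lia.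
have cb : (n%:R ^+ r : R) <= kb * 'C(n, r)%:R.
  by rewrite -natrX -natrM ler_nat expn_le_bin.
have le_c : lam%:R / 'C(n, r)%:R <= kb * eps.
  rewrite exprVn ler_pdivrMr // !mulrA [_ * 'C(_, _)%:R]mulrAC ler_pdivlMr ?exprn_gt0 //.
  by rewrite [kb * _]mulrC -mulrA ler_wpM2l.
have r0 : 0 <= r%:R :> R by exact: ler0n.
have n1 : 1 + 4 * n%:R * (2 * r%:R + 2) <= n%:R * (8 * r%:R + 9) :> R.
  have : 1 <= n%:R :> R by rewrite ler1n (leq_trans _ n4).
  by lra.
have : lam%:R / 'C(n, r)%:R * (1 + 4 * n%:R * (2 * r%:R + 2))
     <= kb * eps * (n%:R * (8 * r%:R + 9)).
  by rewrite ler_pM // ?divr_ge0 // addr_ge0 // !mulr_ge0 // addr_ge0 // mulr_ge0.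
by lra.
Qed.

Lemma no_peak_prob_ge (C : R) (t : nat) : q ^+ r <= 4^-1 ->
  eps * n%:R * l <= C -> t%:R <= 8 * n%:R * (r%:R + 2) * l ->
  expR (- (32 * (r%:R + 2) * C)) <= (1 - 2 * q ^+ r) ^+ (lam * t).
Proof.
move=> qr4 epsl tx.
have qr0 : 0 <= q ^+ r by rewrite exprn_ge0 // invr_ge0.
apply: (@le_trans _ _ (expR (- (4 * q ^+ r)) ^+ (lam * t))); last first.
  rewrite lerXn2r ?nnegrE ?expR_ge0 ?one_sub_ge_expR ?qr0 //.
  by lra.
rewrite -expRM_natl ler_expR mulrN lerN2 natrM.
have -> : lam%:R * t%:R * (4 * q ^+ r) = 4 * eps * t%:R by ring.
apply: le_trans (ler_wpM2l _ tx) _; first by rewrite !mulr_ge0.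
have -> : 4 * eps * (8 * n%:R * (r%:R + 2) * l) = 32 * (r%:R + 2) * (eps * n%:R * l).
  by ring.
by rewrite ler_wpM2l // mulr_ge0 // addr_ge0.
Qed.

Lemma climb_time : 1 <= l -> exists t : nat,
  4 * n%:R * (r%:R + 2) * l <= t%:R <= 8 * n%:R * (r%:R + 2) * l.
Proof.
move=> l1; set x := 4 * n%:R * (r%:R + 2) * l.
have -> : 8 * n%:R * (r%:R + 2) * l = 2 * x by rewrite /x; ring.
have x1 : 1 <= x.
  apply: mulr_ege1 => //; apply: mulr_ege1; last by rewrite -natrD ler1n; lia.
  by rewrite -natrM ler1n; lia.
exists (Num.truncn x).+1; rewrite (ltW (truncnS_gt x)) /= -natr1.
have : (Num.truncn x)%:R <= x by rewrite truncn_le (le_trans ler01).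
by lra.
Qed.

End Constants.

Lemma surv_all1_const (R : realType) (n r lam tau : nat) (C : R) :
  (4 <= n)%N -> (2 * r <= n)%N -> (0 < r)%N -> (0 < lam)%N -> (0 < tau)%N ->
  1 <= ln (n%:R : R) ->
  lam%:R * n%:R^-1 ^+ r * n%:R * ln (n%:R : R) <= C ->
  lam%:R * (n%:R^-1 : R) ^+ r <= 4^-1 ->
  8 * (2 ^ r * r`!)%:R * (8 * r%:R + 9) * (lam%:R * n%:R^-1 ^+ r * n%:R) <= 1 :> R ->
  exists t, expR (- (32 * (r%:R + 2) * C)) / 2 <=
    surv R r tau (complete_graph lam) t (all1_pop n lam).
Proof.
move=> n4 r2n r_gt0 lam_gt0 tau_gt0 l1 epsl eps4 epsn.
have n_ge2 : (2 <= n)%N by exact: leq_trans n4.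
have [t /andP[xt tx]] := climb_time r n4 l1; exists t.
have unclimbed := climb_failure_le n4 eps4 xt.
have hits := peak_hits_le n4 r2n epsn.
have qr4 : (n%:R^-1 : R) ^+ r <= 4^-1.
  by apply: le_trans eps4; rewrite ler_peMl ?ler1n.
have rho_ge := no_peak_prob_ge qr4 epsl tx.
have qr2 : 2 * n%:R^-1 ^+ r <= 1 :> R by move: qr4; clear; lra.
apply: le_trans (surv_all1_ge (complete_graph lam) n_ge2 tau_gt0 r_gt0 r2n t qr2).
rewrite ler_pM ?expR_ge0 ?invr_ge0 //.
by move: unclimbed hits; clear; lra.
Qed.

Theorem theorem6 (R : realType) (r : nat) (lam tau : nat -> nat) :
  (2 <= r)%N ->
  (forall n : nat, 2 * r%:R * ln (n%:R : R) <= (lam n)%:R) ->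
  (exists (C : R) (N0 : nat), 0 < C /\
     forall n : nat, (N0 <= n)%N ->
       (lam n)%:R * ln (n%:R : R) <= C * (n%:R) ^+ (r - 1)) ->
  (forall n : nat, (1 <= tau n)%N) ->
  (forall m n : nat, (m <= n)%N -> (tau m <= tau n)%N) ->
  exists (c : R) (N1 : nat), 0 < c /\
    forall n : nat, (N1 <= n)%N ->
      ((c * (((n%:R) ^+ (3 * r) + (tau n)%:R * (lam n)%:R * (n%:R) ^+ r)
             / ((lam n)%:R * (n%:R) ^+ r + (tau n)%:R * ((lam n)%:R) ^+ 2)))%:E
       <= expected_T R n r (tau n) (complete_graph (lam n)))%E.
Proof.
move=> r2 lam_lo [C [N0 [C0 lam_hi]]] tau_gt0 _.
pose kk : R := 8 * (2 ^ r * r`!)%:R * (8 * r%:R + 9).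
pose M : R := 1 + 4 * C + kk * C.
pose kappa : R := expR (- (32 * (r%:R + 2) * C)).
have kk0 : 0 <= kk by rewrite !mulr_ge0 // addr_ge0 // mulr_ge0.
exists (kappa / 128), (N0 + 2 * r + 4 + (Num.truncn (expR M)).+1)%N.
split=> [|n nN]; first by rewrite divr_gt0 ?expR_gt0.
have [nN0 n4 r2n] : [/\ (N0 <= n)%N, (4 <= n)%N & (2 * r <= n)%N] by split; lia.
have r_gt0 : (0 < r)%N by exact: ltnW.
have n0 : 0 < n%:R :> R by rewrite ltr0n (leq_trans _ n4).
pose l := ln (n%:R : R).
have lM : M <= l.
  rewrite -[M]expRK ler_ln ?posrE ?expR_gt0 //.
  apply/ltW; apply: lt_le_trans (truncnS_gt (expR M)) _; rewrite ler_nat.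
  by apply: leq_trans nN; exact: leq_addl.
have kC0 : 0 <= kk * C by rewrite mulr_ge0 // ltW.
have [l1 l4C lk] : [/\ 1 <= l, 4 * C <= l & kk * C <= l].
  by move: lM kC0 C0; rewrite /M; clear=> *; split; lra.
have l0 : 0 < l by exact: lt_le_trans l1.
have lam_gt0 : (0 < lam n)%N.
  rewrite -(ltr0n R); apply: lt_le_trans (lam_lo n).
  by rewrite mulr_gt0 // mulr_gt0 // ltr0n.
pose eps : R := (lam n)%:R * n%:R^-1 ^+ r.
have eps0 : 0 <= eps by rewrite mulr_ge0 // exprn_ge0 // invr_ge0.
have epsl : eps * n%:R * l <= C.
  rewrite /eps exprVn -mulrA mulrAC ler_pdivrMr ?exprn_gt0 // mulrCA.
  have -> : (n%:R ^+ r : R) = n%:R * n%:R ^+ (r - 1).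
    by rewrite -exprS subn1 prednK.
  by rewrite [C * _]mulrCA ler_wpM2l ?(ltW n0) // lam_hi.
have epsn : kk * (eps * n%:R) <= 1.
  rewrite -(ler_pM2r l0) mul1r -mulrA.
  by apply: le_trans lk; rewrite ler_wpM2l.
have eps4 : eps <= 4^-1.
  have epsnl : eps * l <= eps * n%:R * l.
    by rewrite ler_wpM2r ?(ltW l0) // ler_peMr // ler1n (leq_trans _ n4).
  rewrite -(ler_pM2r l0); apply: le_trans epsnl _; apply: le_trans epsl _.
  by move: l4C; clear; lra.
have [t surv_ge] := surv_all1_const n4 r2n r_gt0 lam_gt0 (tau_gt0 n) l1 epsl eps4 epsn.
have n_ge2 : (2 <= n)%N by exact: leq_trans n4.
apply: le_trans (expected_T_ge n_ge2 (tau_gt0 n) r_gt0 r2n lam_gt0 eps4 t).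
rewrite lee_fin.
have hA_ge0 : 0 <= hA R n r (lam n) (tau n) by apply/ltW; exact: hA_gt0.
apply: le_trans (ler_wpM2r hA_ge0 surv_ge).
have -> : kappa / 2 * hA R n r (lam n) (tau n) =
    kappa / 128 * (64 * hA R n r (lam n) (tau n)) by field.
rewrite ler_wpM2l ?divr_ge0 ?expR_ge0 //.
by apply: target_le_hA => //; exact: ltnW.
Qed.
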